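(* Let $n\ge 1$ and let $\pi\colon\overline{\mathcal D_n}\to\mathbb{RP}^{n-1}$ be the natural projection from the Chabauty closure of the space of diagonal orthogonal groups in $\mathrm{GL}(n;\mathbb R)$. If $p\in\mathbb{RP}^{n-1}$ lies in a $k$-dimensional cell of the coordinate hyperplane arrangement, then the fiber $\pi^{-1}(p)$ is homeomorphic to $\overline{\mathcal D_{n-k-1}}$.
   Context: For a Lie group $G$, $\mathfrak C(G)$ denotes the space of closed subgroups of $G$ with the Chabauty topology. For a nondegenerate symmetric matrix $J\in\mathrm{GL}(m;\mathbb R)$ put $\mathrm O(J)=\{A\in\mathrm{GL}(m;\mathbb R): A^TJA=J\}$. For $m\ge1$ let $\mathcal D_m=\{\mathrm O(D): D\in\mathrm{GL}(m;\mathbb R)\text{ diagonal}\}\subset\mathfrak C(\mathrm{GL}(m;\mathbb R))$, and let $\overline{\mathcal D_m}$ be its closure in $\mathfrak C(\mathrm{GL}(m;\mathbb R))$. By convention $\overline{\mathcal D_0}$ is a single point. The map $\pi\colon\overline{\mathcal D_n}\to\mathbb{RP}^{n-1}$ (where $\mathbb{RP}^{n-1}$ is identified with the projectivization of the space of diagonal $n\times n$ matrices) is the natural map sending $\mathrm O(D)$ to $[D]$ and a degeneration $L=\lim_t\mathrm O(D_t)$ to the limit $\lim_t[D_t]$ of the associated projective classes of forms. The coordinate hyperplanes $\{x_i=0\}$ and their intersections cellulate $\mathbb{RP}^{n-1}$: the open $k$-cells are the connected components of the sets of points $[x_1:\cdots:x_n]$ having exactly $k+1$ nonzero coordinates, in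 prescribed positions. *)

(* Defs.v *)
From HB Require Import structures.
From mathcomp Require Import all_boot all_order all_algebra.
From mathcomp Require Import generic_quotient.
From mathcomp Require Import all_classical all_reals all_analysis.

Set Implicit Arguments.
Unset Strict Implicit.
Unset Printing Implicit Defensive.

Import Order.TTheory GRing.Theory Num.Theory.
Import numFieldNormedType.Exports.

Local Open Scope classical_set_scope.
Local Open Scope ring_scope.
Local Open Scope quotient_scope.

Definition homeomorphic (X Y : topologicalType) : Prop :=
  exists (f : X -> Y) (g : Y -> X),
    [/\ cancel f g, cancel g f, continuous f & continuous g].

(* Continuity of the group operations is not recorded: neither the set of
   closed subgroups nor its Chabauty topology refers to it. *)
#[short(type="preTopologicalGroupType")]
HB.structure Definition PreTopologicalGroup := {G of Topological G & Group G}.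

Section Chabauty.
Variable G : preTopologicalGroupType.
Local Open Scope group_scope.

Record closed_subgroup := ClosedSubgroup {
  subgroup_set :> set G;
  closed_subgroup_closed : closed subgroup_set;
  closed_subgroup1 : subgroup_set 1;
  closed_subgroupM : forall x y,
    subgroup_set x -> subgroup_set y -> subgroup_set (x * y);
  closed_subgroupV : forall x, subgroup_set x -> subgroup_set x^-1 }.

HB.instance Definition _ := gen_eqMixin closed_subgroup.
HB.instance Definition _ := gen_choiceMixin closed_subgroup.

Definition chabauty_miss (K : set G) : set closed_subgroup :=
  [set H | (H : set G) `&` K = set0].

Definition chabauty_hit (U : set G) : set closed_subgroup :=
  [set H | (H : set G) `&` U !=set0].

Definition chabauty_subbase : set (set closed_subgroup) :=
  chabauty_miss @` [set K | compact K] `|` chabauty_hit @` [set U | open U].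

HB.instance Definition _ :=
  isSubBaseTopological.Build closed_subgroup chabauty_subbase id.

End Chabauty.

Section GeneralLinear.
Variables (R : realType) (m : nat).

Definition GL := set_type [set A : 'M[R]_m | A \in unitmx].

HB.instance Definition _ := Topological.on GL.

Definition GLmx (A : GL) : 'M[R]_m := set_val A.

Lemma GLmx_inj : injective GLmx.
Proof. exact: val_inj. Qed.

Lemma GLmx_unit (A : GL) : GLmx A \in unitmx.
Proof. exact: (set_valP A). Qed.

Definition GLmk (A : 'M[R]_m) (uA : A \in unitmx) : GL :=
  SigSub (mem_set uA : A \in [set A : 'M[R]_m | A \in unitmx]).

Lemma GLmxK (A : 'M[R]_m) (uA : A \in unitmx) : GLmx (GLmk uA) = A.
Proof. by rewrite /GLmx set_valE. Qed.

Definition GL1 : GL := GLmk (unitmx1 R m).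

Lemma GLmul_subproof (A B : GL) : GLmx A *m GLmx B \in unitmx.
Proof. by rewrite unitmx_mul !GLmx_unit. Qed.

Definition GLmul (A B : GL) : GL := GLmk (GLmul_subproof A B).

Lemma GLinv_subproof (A : GL) : invmx (GLmx A) \in unitmx.
Proof. by rewrite unitmx_inv GLmx_unit. Qed.

Definition GLinv (A : GL) : GL := GLmk (GLinv_subproof A).

Lemma GLmulA : associative GLmul.
Proof. by move=> A B C; apply: GLmx_inj; rewrite !GLmxK mulmxA. Qed.

Lemma GLmul1 : left_id GL1 GLmul.
Proof. by move=> A; apply: GLmx_inj; rewrite !GLmxK mul1mx. Qed.

Lemma GLmulr1 : right_id GL1 GLmul.
Proof. by move=> A; apply: GLmx_inj; rewrite !GLmxK mulmx1. Qed.

Lemma GLmulV : left_inverse GL1 GLinv GLmul.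
Proof. by move=> A; apply: GLmx_inj; rewrite !GLmxK mulVmx ?GLmx_unit. Qed.

Lemma GLmulrV : right_inverse GL1 GLinv GLmul.
Proof. by move=> A; apply: GLmx_inj; rewrite !GLmxK mulmxV ?GLmx_unit. Qed.

HB.instance Definition _ :=
  isGroup.Build GL GLmulA GLmul1 GLmulr1 GLmulV GLmulrV.

End GeneralLinear.

Section OrthogonalGroup.
Variables (R : realType) (m : nat).

Definition orthogonal_set (J : 'M[R]_m) : set (GL R m) :=
  [set A | (GLmx A)^T *m J *m GLmx A = J].

Lemma GLmx_continuous : continuous (@GLmx R m).
Proof. exact: initial_continuous. Qed.

Lemma orthogonal_set_closed (J : 'M[R]_m) : closed (orthogonal_set J).
Proof.
pose q i j (A : GL R m) := ((GLmx A)^T *m J *m GLmx A) i j.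
have cq i j : continuous (q i j : GL R m -> R).
  have entry k l : continuous (fun A : GL R m => GLmx A k l : R).
    move=> A; apply: (@continuous_comp _ _ _ (@GLmx R m) (fun M => M k l)).
      exact: GLmx_continuous.
    exact: coord_continuous.
  have -> : q i j = fun A : GL R m =>
      \sum_k (\sum_l GLmx A l i * J l k) * GLmx A k j.
    apply/funext => A; rewrite /q mxE; apply: eq_bigr => k _.
    by rewrite mxE; congr (_ * _); apply: eq_bigr => l _; rewrite mxE.
  have sumC (F : 'I_m -> GL R m -> R) :
      (forall k, continuous (F k)) -> continuous (fun A => \sum_k F k A).
    move=> cF A; apply: (@cvg_big _ _ _ _ _ add_continuous _ (nbhs A)).
    by move=> k _; exact: cF.
  have mulC (f g : GL R m -> R) :
      continuous f -> continuous g -> continuous (fun A => f A * g A).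
    move=> cf cg A.
    by have := @cvgM _ _ (nbhs A) _ f g _ _ (cf A) (cg A); apply.
  apply: (sumC) => k; apply: (mulC); last exact: entry.
  apply: (sumC) => l; apply: (mulC); first exact: entry.
  exact: cst_continuous.
have -> : orthogonal_set J =
    \bigcap_ij (q ij.1 ij.2 @^-1` [set x : R | x = J ij.1 ij.2]).
  apply/seteqP; split=> [A /= AJ ij _ /=|A AJ]; first by rewrite /q AJ.
  by apply/matrixP => i j; exact: (AJ (i, j)).
apply: closed_bigI => -[i j] _ /=.
by apply: preimage_closed => [A _|]; [exact: cq | exact: closed_eq].
Qed.

Lemma orthogonal_set1 (J : 'M[R]_m) : orthogonal_set J 1%g.
Proof. by rewrite /orthogonal_set /= GLmxK trmx1 mul1mx mulmx1. Qed.

Lemma orthogonal_setM (J : 'M[R]_m) (A B : GL R m) :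
  orthogonal_set J A -> orthogonal_set J B -> orthogonal_set J (A * B)%g.
Proof.
rewrite /orthogonal_set /= GLmxK => AJ BJ.
by rewrite trmx_mul -{2}BJ -{2}AJ !mulmxA.
Qed.

Lemma orthogonal_setV (J : 'M[R]_m) (A : GL R m) :
  orthogonal_set J A -> orthogonal_set J A^-1%g.
Proof.
rewrite /orthogonal_set /= GLmxK => AJ; have uA := GLmx_unit A.
rewrite -{1}AJ trmx_inv !mulmxA mulVmx ?unitmx_tr // mul1mx.
by rewrite -mulmxA mulmxV // mulmx1.
Qed.

Definition orthogonal_group (J : 'M[R]_m) : closed_subgroup (GL R m) :=
  ClosedSubgroup (@orthogonal_set_closed J) (orthogonal_set1 J)
    (@orthogonal_setM J) (@orthogonal_setV J).

(* For m = 0 this is the one-element set containing the trivial group. *)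
Definition diag_orthogonal_groups : set (closed_subgroup (GL R m)) :=
  [set orthogonal_group (diag_mx d) | d in [set d | diag_mx d \in unitmx]].

Definition Dbar : topologicalType :=
  set_type (closure diag_orthogonal_groups).

End OrthogonalGroup.

Section RealProjectiveSpace.
Variables (R : realType) (n : nat).

Definition nonzero_vector := set_type [set v : 'rV[R]_n.+1 | v != 0].
HB.instance Definition _ := Topological.on nonzero_vector.

Definition vector_of (v : nonzero_vector) : 'rV[R]_n.+1 := set_val v.

Definition proportional (u v : nonzero_vector) : bool :=
  `[< exists2 c : R, c != 0 & vector_of u = c *: vector_of v >].

Lemma proportional_refl : reflexive proportional.
Proof. by move=> u; apply/asboolP; exists 1; rewrite ?oner_neq0 ?scale1r. Qed.

Lemma proportional_sym : symmetric proportional.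
Proof.
suff sym u v : proportional u v -> proportional v u.
  by move=> u v; apply/idP/idP; exact: sym.
move=> /asboolP[c c0 uv]; apply/asboolP; exists c^-1; first by rewrite invr_eq0.
by rewrite uv scalerA mulVf // scale1r.
Qed.

Lemma proportional_trans : transitive proportional.
Proof.
move=> v u w /asboolP[c c0 uv] /asboolP[e e0 vw]; apply/asboolP.
by exists (c * e); rewrite ?mulf_neq0 // uv vw scalerA.
Qed.

Definition proportional_equiv :=
  EquivRel proportional
    proportional_refl proportional_sym proportional_trans.

(* RP n is RP^n, with the quotient topology.  The nonzero vector d stands for
   the diagonal matrix diag_mx d. *)
Definition RP := quotient_topology {eq_quot proportional_equiv}.
HB.instance Definition _ := Topological.on RP.

Definition RPclass (v : nonzero_vector) : RP :=
  \pi_(quotient_topology {eq_quot proportional_equiv}) v.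

Lemma const_mx1_neq0 : (const_mx 1 : 'rV[R]_n.+1) != 0.
Proof.
by apply/eqP => /rowP/(_ ord0)/eqP; rewrite !mxE oner_eq0.
Qed.

HB.instance Definition _ := isPointed.Build RP
  (RPclass (SigSub
    (mem_set const_mx1_neq0 : _ \in [set v : 'rV[R]_n.+1 | v != 0]))).

Definition coordinate_stratum (I : {set 'I_n.+1}) : set RP :=
  RPclass @` [set v | forall i, (vector_of v 0 i != 0) = (i \in I)].

Definition open_cell (k : nat) (C : set RP) : Prop :=
  exists (I : {set 'I_n.+1}) (p : RP),
    [/\ #|I| = k.+1, coordinate_stratum I p &
        C = connected_component (coordinate_stratum I) p].

Definition in_cell (k : nat) (p : RP) : Prop :=
  exists2 C, open_cell k C & C p.

End RealProjectiveSpace.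

Section Projection.
Variables (R : realType) (n : nat).

Definition limit_form (L : Dbar R n.+1) (p : RP R n) : Prop :=
  exists d : nat -> nonzero_vector R n,
    [/\ forall t, diag_mx (vector_of (d t)) \in unitmx,
        orthogonal_group (diag_mx (vector_of (d t))) @[t --> \oo] -->
          (set_val L : closed_subgroup (GL R n.+1)) &
        RPclass (d t) @[t --> \oo] --> p].

(* Each L has exactly one limit form, independent of the sequence chosen;
   constant sequences give O(D) |-> [D]. *)
Definition projection (L : Dbar R n.+1) : RP R n := get (limit_form L).

Definition fiber (p : RP R n) : topologicalType :=
  set_type (projection @^-1` [set p]).

End Projection.

(* Main.v *)
Require Import Defs.
From mathcomp Require Import all_boot all_order all_algebra.
From mathcomp Require Import finmap generic_quotient ring.
From mathcomp Require Import all_classical all_reals all_analysis.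

Set Implicit Arguments.
Unset Strict Implicit.
Unset Printing Implicit Defensive.

Import Order.TTheory GRing.Theory Num.Theory.
Import numFieldNormedType.Exports.

Local Open Scope classical_set_scope.
Local Open Scope ring_scope.

(** Let D_t be nondegenerate diagonal forms converging, after rescaling, to a
    form v with zero set J, and let E_t be the restriction of D_t to the
    coordinates in J.  Split the coordinates into the support of v and J.  A
    limit A of elements of O(D_t) preserves v, hence is block lower triangular:
    its support block lies in O(v), its lower left block is arbitrary, and its
    J-block is a limit of elements of O(E_t).  Conversely every such A is
    reached.  So O(D_t) converges exactly when O(E_t) does, and the limit of the
    former is the group [block_group] of the matrices that preserve v and have
    their J-block in the limit of the latter.  As the E_t can be rescaled freely
    without changing O(E_t), any point of the closure of the diagonal orthogonal
    groups in dimension |J| occurs.  Sending it to its block group is the wanted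
    bijection onto the fiber over [v], and it is a homeomorphism because the
    block map has the continuous section h |-> diag(1, h).

    Both inclusions rest on one perturbation lemma, [orthogonal_approx]: if B_t
    tends to an invertible B and the D_t-adjoints D_t^-1 B_t^T D_t tend to B^-1,
    then B is a limit of exact elements of O(D_t), no matter how badly
    conditioned D_t becomes.  For the J-block of A_t in O(D_t) the hypothesis
    holds since taking adjoints commutes with taking J-blocks ([cvg_block]); for
    the converse the vanishing block of A is replaced by the small block that
    makes the adjoint converge ([cvg_lift]).

    The projection is defined by a choice among limit forms along sequences, so
    three more facts are needed.  The Chabauty space is first countable, so
    closure points are limits of sequences ([chabauty_closure_seq]).  A limit
    form exists, by compactness of the unit sphere ([limit_form_exists]).  It is
    unique ([limit_form_unique]): the limit group contains a reflection of the
    form v in a vector with nonzero coordinates, and the only diagonal forms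
    invariant under this reflection are the multiples of v. *)

(** * Limits of matrices *)

Section MatrixLimits.
Variables (R : realType) (T : Type) (F : set_system T).
Context {FF : Filter F}.

Lemma mx_cvgP m n (A_ : T -> 'M[R]_(m, n)) (A : 'M[R]_(m, n)) :
  A_ t @[t --> F] --> A <-> forall i j, A_ t i j @[t --> F] --> A i j.
Proof.
split=> [cA i j U nU|cA U [P nP PU]].
  apply: (cA [set M : 'M[R]_(m, n) | U (M i j)]).
  exists (fun k l => [set x | k = i -> l = j -> U x]) => [k l|M]; last exact.
  have [ki|/eqP ki] := eqVneq k i; last by apply: filterS filterT => x _ /ki.
  have [lj|/eqP lj] := eqVneq l j; last by apply: filterS filterT => x _ _ /lj.
  by rewrite ki lj; apply: filterS nU => x Ux _ _.
rewrite /nbhs /=.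
have : \near F, forall i j, P i j (A_ F i j).
  apply: filter_forall => i; apply: filter_forall => j; exact: (cA i j).
by apply: filterS => t; exact: PU.
Qed.

Lemma cvg_mulmx m n p (A_ : T -> 'M[R]_(m, n)) (B_ : T -> 'M[R]_(n, p))
    (A : 'M[R]_(m, n)) (B : 'M[R]_(n, p)) :
  A_ t @[t --> F] --> A -> B_ t @[t --> F] --> B ->
  A_ t *m B_ t @[t --> F] --> A *m B.
Proof.
move=> /mx_cvgP cA /mx_cvgP cB; apply/mx_cvgP => i j; rewrite mxE.
under eq_fun do rewrite mxE.
apply: (@cvg_big R _ +%R 0 xpredT add_continuous _ F) => k _.
exact: cvgM.
Qed.

Lemma cvg_addmx m n (A_ B_ : T -> 'M[R]_(m, n)) (A B : 'M[R]_(m, n)) :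
  A_ t @[t --> F] --> A -> B_ t @[t --> F] --> B ->
  A_ t + B_ t @[t --> F] --> A + B.
Proof.
move=> /mx_cvgP cA /mx_cvgP cB; apply/mx_cvgP => i j; rewrite mxE.
by under eq_fun do rewrite mxE; exact: cvgD.
Qed.

Lemma cvg_oppmx m n (A_ : T -> 'M[R]_(m, n)) (A : 'M[R]_(m, n)) :
  A_ t @[t --> F] --> A -> - A_ t @[t --> F] --> - A.
Proof.
move=> /mx_cvgP cA; apply/mx_cvgP => i j; rewrite mxE.
by under eq_fun do rewrite mxE; exact: cvgN.
Qed.

Lemma cvg_submx m n (A_ B_ : T -> 'M[R]_(m, n)) (A B : 'M[R]_(m, n)) :
  A_ t @[t --> F] --> A -> B_ t @[t --> F] --> B ->
  A_ t - B_ t @[t --> F] --> A - B.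
Proof. by move=> cA cB; apply: cvg_addmx => //; exact: cvg_oppmx. Qed.

Lemma cvg_scalemx m n (c_ : T -> R) (A_ : T -> 'M[R]_(m, n)) (c : R)
    (A : 'M[R]_(m, n)) :
  c_ t @[t --> F] --> c -> A_ t @[t --> F] --> A ->
  c_ t *: A_ t @[t --> F] --> c *: A.
Proof.
move=> cc /mx_cvgP cA; apply/mx_cvgP => i j; rewrite mxE.
by under eq_fun do rewrite mxE; exact: cvgM.
Qed.

Lemma cvg_trmx m n (A_ : T -> 'M[R]_(m, n)) (A : 'M[R]_(m, n)) :
  A_ t @[t --> F] --> A -> (A_ t)^T @[t --> F] --> A^T.
Proof.
move=> /mx_cvgP cA; apply/mx_cvgP => i j; rewrite mxE.
by under eq_fun do rewrite mxE; exact: cA.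
Qed.

Lemma cvg_diag_mx m (d_ : T -> 'rV[R]_m) (d : 'rV[R]_m) :
  d_ t @[t --> F] --> d -> diag_mx (d_ t) @[t --> F] --> diag_mx d.
Proof.
move=> /mx_cvgP cd; apply/mx_cvgP => i j; rewrite mxE.
under eq_fun do rewrite mxE.
by case: eqP => _; [exact: cd | exact: cvg_cst].
Qed.

Lemma cvg_det m (A_ : T -> 'M[R]_m) (A : 'M[R]_m) :
  A_ t @[t --> F] --> A -> \det (A_ t) @[t --> F] --> \det A.
Proof.
move=> /mx_cvgP cA; rewrite /determinant.
apply: (@cvg_big R _ +%R 0 xpredT add_continuous _ F) => s _.
apply: cvgM; first exact: cvg_cst.
apply: (@cvg_big R _ *%R 1 xpredT mul_continuous _ F) => i _; exact: cA.
Qed.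

Lemma near_unitmx m (A_ : T -> 'M[R]_m) (A : 'M[R]_m) :
  A_ t @[t --> F] --> A -> A \in unitmx -> \forall t \near F, A_ t \in unitmx.
Proof.
move=> /cvg_det cA uA.
have dA0 : \det A != 0 by rewrite unitmxE unitfE in uA.
have nd : nbhs (\det A) [set x : R | x != 0].
  by apply: open_nbhs_nbhs; split=> //; exact: open_neq.
have : \forall t \near F, \det (A_ t) != 0 := cA _ nd.
by apply: filterS => t dAt; rewrite unitmxE unitfE.
Qed.

Lemma cvg_invmx m (A_ : T -> 'M[R]_m) (A : 'M[R]_m) :
  A_ t @[t --> F] --> A -> A \in unitmx ->
  invmx (A_ t) @[t --> F] --> invmx A.
Proof.
move=> cA uA.
suff : (\det (A_ t))^-1 *: \adj (A_ t) @[t --> F] --> invmx A.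
  apply: cvg_trans; apply: near_eq_cvg.
  by apply: filterS (near_unitmx cA uA) => t uAt; rewrite /invmx uAt.
rewrite /invmx uA; apply: cvg_scalemx.
  apply: cvgV; last exact: cvg_det.
  by rewrite unitmxE unitfE in uA.
have {}cA := (mx_cvgP _ _).1 cA.
apply/mx_cvgP => i j; rewrite mxE; under eq_fun do rewrite mxE.
apply: cvgM; first exact: cvg_cst.
apply: cvg_det; apply/mx_cvgP => k l; rewrite !mxE.
by under eq_fun do rewrite !mxE; exact: cA.
Qed.

Lemma mx_cvg_unique m n (A_ : T -> 'M[R]_(m, n)) (A B : 'M[R]_(m, n)) :
  ProperFilter F ->
  A_ t @[t --> F] --> A -> A_ t @[t --> F] --> B -> A = B.
Proof.
move=> PF /mx_cvgP cA /mx_cvgP cB; apply/matrixP => i j.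
exact: (cvg_unique _ (cA i j) (cB i j)).
Qed.

End MatrixLimits.

(** * Adjoints with respect to a diagonal form *)

Definition preserves (R : realType) n (d : 'rV[R]_n) (A : 'M[R]_n) :=
  A^T *m diag_mx d *m A = diag_mx d.

Section FormAdjoint.
Variables (R : realType) (n : nat).
Implicit Types (d : 'rV[R]_n) (M N : 'M[R]_n).

Definition form_adjoint d M := invmx (diag_mx d) *m M^T *m diag_mx d.

Lemma form_adjointM d M N : diag_mx d \in unitmx ->
  form_adjoint d (M *m N) = form_adjoint d N *m form_adjoint d M.
Proof.
by move=> ud; rewrite /form_adjoint trmx_mul !mulmxA mulmxK ?mulmxA.
Qed.

Lemma form_adjoint1 d : diag_mx d \in unitmx -> form_adjoint d 1%:M = 1%:M.
Proof. by move=> ud; rewrite /form_adjoint trmx1 mulmx1 mulVmx. Qed.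

Lemma form_adjointD d M N :
  form_adjoint d (M + N) = form_adjoint d M + form_adjoint d N.
Proof. by rewrite /form_adjoint linearD mulmxDr mulmxDl. Qed.

Lemma form_adjointB d M N :
  form_adjoint d (M - N) = form_adjoint d M - form_adjoint d N.
Proof. by rewrite /form_adjoint linearB mulmxBr mulmxBl. Qed.

Lemma form_adjointZ d c M : form_adjoint d (c *: M) = c *: form_adjoint d M.
Proof. by rewrite /form_adjoint linearZ -scalemxAr -scalemxAl. Qed.

Lemma form_adjointK d M : diag_mx d \in unitmx ->
  form_adjoint d (form_adjoint d M) = M.
Proof.
move=> ud; rewrite /form_adjoint !trmx_mul trmxK trmx_inv tr_diag_mx !mulmxA.
by rewrite mulVmx // mul1mx mulmxKV.
Qed.

Lemma form_adjoint_unit d M : diag_mx d \in unitmx ->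
  (form_adjoint d M \in unitmx) = (M \in unitmx).
Proof.
by move=> ud; rewrite /form_adjoint !unitmx_mul unitmx_inv unitmx_tr ud andbT.
Qed.

Lemma form_adjointV d M : diag_mx d \in unitmx ->
  form_adjoint d (invmx M) = invmx (form_adjoint d M).
Proof.
move=> ud; have [uM|uM] := boolP (M \in unitmx); last first.
  have uaM : form_adjoint d M \notin unitmx by rewrite form_adjoint_unit.
  by rewrite (invmx_out uM) (invmx_out uaM).
have uA : form_adjoint d M \in unitmx by rewrite form_adjoint_unit.
apply: (can_inj (mulKmx uA)).
by rewrite mulmxV // -form_adjointM // mulVmx // form_adjoint1.
Qed.

Lemma preserves_formP d M : diag_mx d \in unitmx ->
  preserves d M <-> form_adjoint d M *m M = 1%:M.
Proof.
move=> ud; rewrite /preserves /form_adjoint -!mulmxA.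
split=> [->|]; first exact: mulVmx.
by move=> /(congr1 (mulmx (diag_mx d))); rewrite mulKVmx // mulmx1.
Qed.

Lemma form_adjoint_preserves d M : diag_mx d \in unitmx ->
  preserves d M -> form_adjoint d M = invmx M.
Proof.
move=> ud /(preserves_formP _ ud) aM.
have [_ uM] := mulmx1_unit aM.
by rewrite -[LHS](mulmxK uM) aM mul1mx.
Qed.

End FormAdjoint.

(** * Approximation by orthogonal matrices *)

Section OrthogonalApproximation.
Variables (R : realType).

Lemma comm_mx_inv n (A B : 'M[R]_n) :
  B \in unitmx -> comm_mx A B -> A *m invmx B = invmx B *m A.
Proof.
move=> uB AB; apply: (can_inj (mulKmx uB)); apply: (can_inj (mulmxK uB)).
by rewrite mulKVmx // -!mulmxA mulVmx // mulmx1.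
Qed.

Lemma comm_mx_subD n (M N : 'M[R]_n) :
  comm_mx M N -> comm_mx (M - N) (M + N).
Proof.
by move=> MN; apply: comm_mxD; apply: comm_mx_sym; apply: comm_mxB => //;
   exact: comm_mx_sym.
Qed.

(** The determinant is affine in each diagonal sign, with slope the complementary
    minor, so a choice of signs that makes the minor nonzero extends. *)
Lemma sign_shift_unit n (B : 'M[R]_n) :
  exists2 s : 'rV[R]_n, (forall i, s 0 i * s 0 i = 1) &
    diag_mx s + B \in unitmx.
Proof.
elim: n B => [|n IHn] B.
  by exists 0 => [[]//|]; rewrite unitmxE det_mx00 unitr1.
have [s ss us] := IHn (row' ord0 (col' ord0 B)).
pose S e : 'rV[R]_n.+1 := \row_i (if unlift ord0 i is Some j then s 0 j else e).
have SS e : e * e = 1 -> forall i, S e 0 i * S e 0 i = 1.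
  by move=> ee i; rewrite mxE; case: unliftP => [j|] _.
pose c := \det (diag_mx s + row' ord0 (col' ord0 B)).
have detS e : \det (diag_mx (S e) + B) = e * c + \det (diag_mx (S 0) + B).
  rewrite !(expand_det_row _ ord0) !big_ord_recl /= !mxE !eqxx !unlift_none !mulr1n.
  have cof j (e1 e2 : R) : cofactor (diag_mx (S e1) + B) ord0 j =
      cofactor (diag_mx (S e2) + B) ord0 j.
    rewrite /cofactor; congr (_ * \det _); apply/matrixP => k l.
    by rewrite !mxE !liftK.
  rewrite (cof _ e 0) addrA add0r mulrDl -!addrA; congr (_ + (_ + _)).
    congr (_ * _); rewrite /cofactor expr0 mul1r; congr (\det _).
    apply/matrixP => k l; rewrite !mxE liftK.
    by rewrite (inj_eq lift_inj).
  apply: eq_bigr => k _; rewrite (cof _ e 0); congr (_ * _).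
  by rewrite !mxE.
have c0 : c != 0 by move: us; rewrite unitmxE unitfE.
have [d0|d0] := eqVneq (\det (diag_mx (S 1) + B)) 0; last first.
  by exists (S 1); [apply: SS; rewrite mulr1 | rewrite unitmxE unitfE].
exists (S (-1)); first by apply: SS; rewrite mulrNN mulr1.
rewrite unitmxE unitfE detS mulN1r.
move: d0; rewrite detS mul1r => /eqP; rewrite addrC addr_eq0 => /eqP ->.
by rewrite -opprD oppr_eq0 -mulr2n mulrn_eq0.
Qed.

Variables (T : Type) (F : set_system T).
Context {FF : Filter F}.

(** The inverse Cayley transform X of B_t is in the limit skew for the adjoint,
    because the adjoint of B_t tends to the inverse of B.  Replacing X by its skew
    part Y changes it by a term that vanishes in the limit, and the Cayley
    transform of a skew matrix is exactly orthogonal. *)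
Lemma orthogonal_approx_cayley n (d_ : T -> 'rV[R]_n) (B_ : T -> 'M[R]_n)
    (B : 'M[R]_n) :
  (forall t, diag_mx (d_ t) \in unitmx) ->
  B_ t @[t --> F] --> B -> B \in unitmx -> B + 1%:M \in unitmx ->
  form_adjoint (d_ t) (B_ t) @[t --> F] --> invmx B ->
  exists2 A_ : T -> 'M[R]_n,
    forall t, preserves (d_ t) (A_ t) &
    A_ t @[t --> F] --> B.
Proof.
move=> ud cB uB uB1 cB'.
pose X t := (B_ t - 1%:M) *m invmx (B_ t + 1%:M).
pose X' := (B - 1%:M) *m invmx (B + 1%:M).
pose Y t := 2^-1 *: (X t - form_adjoint (d_ t) (X t)).
have c1 : (1%:M : 'M[R]_n) @[t --> F] --> (1%:M : 'M[R]_n) by exact: cvg_cst.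
have cX : X t @[t --> F] --> X'.
  exact: cvg_mulmx (cvg_submx cB c1) (cvg_invmx (cvg_addmx cB c1) uB1).
have uC1 : invmx B + 1%:M \in unitmx.
  have -> : invmx B + 1%:M = invmx B *m (B + 1%:M).
    by rewrite mulmxDr mulVmx // mulmx1 addrC.
  by rewrite unitmx_mul unitmx_inv uB.
have cXa : form_adjoint (d_ t) (X t) @[t --> F] --> - X'.
  have -> : - X' = invmx (invmx B + 1%:M) *m (invmx B - 1%:M).
    have commB := comm_mx_subD (comm_mx1 B).
    rewrite /X' (comm_mx_inv uB1 commB).
    apply: (can_inj (mulKmx uC1)); rewrite mulKVmx //.
    have -> : invmx B + 1%:M = invmx B *m (B + 1%:M).
      by rewrite mulmxDr mulVmx // mulmx1 addrC.
    rewrite -mulmxA mulmxN mulKVmx // mulmxN mulmxBr mulVmx // mulmx1.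
    by rewrite opprB.
  under eq_fun do rewrite /X form_adjointM // form_adjointV // form_adjointD
    form_adjointB !form_adjoint1 //.
  exact: cvg_mulmx (cvg_invmx (cvg_addmx cB' c1) uC1) (cvg_submx cB' c1).
have cY : Y t @[t --> F] --> X'.
  have -> : X' = 2^-1 *: (X' - - X').
    by rewrite opprK -mulr2n -[X' *+ 2]scaler_nat scalerA mulVf ?scale1r ?pnatr_eq0.
  exact: cvg_scalemx (cvg_cst _) (cvg_submx cX cXa).
have aY t : form_adjoint (d_ t) (Y t) = - Y t.
  by rewrite form_adjointZ form_adjointB form_adjointK // -scalerN opprB.
have eX : 1%:M - X' = 2 *: invmx (B + 1%:M).
  rewrite -[X in X - _](mulmxV uB1) /X' -mulmxBl opprB [in LHS]addrC.
  by rewrite [1%:M - B + _]addrA subrK mulmxDl mul1mx -mulr2n -[_ *+ 2]scaler_nat.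
have eX' : 1%:M + X' = 2 *: (B *m invmx (B + 1%:M)).
  rewrite -[X in X + _](mulmxV uB1) /X' -mulmxDl addrACA subrr addr0.
  by rewrite -mulr2n -[B *+ 2]scaler_nat -scalemxAl.
have uX : 1%:M - X' \in unitmx.
  rewrite eX -mul_scalar_mx unitmx_mul unitmx_inv uB1 andbT.
  by rewrite unitmxE det_scalar unitfE expf_neq0 // pnatr_eq0.
(* 1 - Y t is only eventually invertible; the identity serves for other t. *)
exists (fun t => if 1%:M - Y t \in unitmx
                 then invmx (1%:M - Y t) *m (1%:M + Y t) else 1%:M) => [t|].
  case: ifPn => uY; last by rewrite /preserves trmx1 mul1mx mulmx1.
  apply/preserves_formP => //.
  have uY' : 1%:M + Y t \in unitmx.
    rewrite -(form_adjoint_unit _ (ud t)) form_adjointD form_adjoint1 //.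
    by rewrite aY.
  rewrite form_adjointM // form_adjointV // form_adjointB form_adjointD.
  rewrite form_adjoint1 // aY opprK.
  rewrite (comm_mx_inv uY' (comm_mx_subD (comm1mx _))).
  by rewrite mulmxA mulmxK // mulVmx.
have -> : B = invmx (1%:M - X') *m (1%:M + X').
  apply: (can_inj (mulKmx uX)); rewrite mulKVmx // eX eX' -scalemxAl.
  by rewrite (comm_mx_inv uB1) //; apply: comm_mxD => //; exact: comm_mx1.
apply: (@cvg_trans _ (invmx (1%:M - Y t) *m (1%:M + Y t) @[t --> F])).
  apply: near_eq_cvg.
  by apply: filterS (near_unitmx (cvg_submx c1 cY) uX) => t ->.
exact: cvg_mulmx (cvg_invmx (cvg_submx c1 cY) uX) (cvg_addmx c1 cY).
Qed.

(** Diagonal sign matrices preserve every diagonal form; multiplying by one of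
    them removes the eigenvalue -1, where the Cayley transform is undefined. *)
Lemma orthogonal_approx n (d_ : T -> 'rV[R]_n) (B_ : T -> 'M[R]_n)
    (B : 'M[R]_n) :
  (forall t, diag_mx (d_ t) \in unitmx) ->
  B_ t @[t --> F] --> B -> B \in unitmx ->
  form_adjoint (d_ t) (B_ t) @[t --> F] --> invmx B ->
  exists2 A_ : T -> 'M[R]_n,
    forall t, preserves (d_ t) (A_ t) &
    A_ t @[t --> F] --> B.
Proof.
move=> ud cB uB cB'.
have [s ss us] := sign_shift_unit B.
pose S := diag_mx s.
have SS : S *m S = 1%:M.
  by rewrite mulmx_diag; apply/matrixP => i j; rewrite !mxE ss.
have uS : S \in unitmx by have [] := mulmx1_unit SS.
have St : S^T = S by rewrite tr_diag_mx.
have Sd d : S *m diag_mx d = diag_mx d *m S.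
  by rewrite !mulmx_diag; congr diag_mx; apply/rowP => i; rewrite !mxE mulrC.
have Sa t : form_adjoint (d_ t) S = S.
  by rewrite /form_adjoint St -mulmxA Sd mulKmx.
have iS : invmx S = S by apply: (can_inj (mulKmx uS)); rewrite mulmxV.
have cS : (S : 'M[R]_n) @[t --> F] --> S by exact: cvg_cst.
have [||||A_ oA cA] := @orthogonal_approx_cayley n d_ (fun t => S *m B_ t) (S *m B) ud.
- exact: cvg_mulmx cS cB.
- by rewrite unitmx_mul uS.
- have -> : S *m B + 1%:M = S *m (S + B) by rewrite mulmxDr SS addrC.
  by rewrite unitmx_mul uS.
- under eq_fun do rewrite form_adjointM // Sa.
  have -> : invmx (S *m B) = invmx B *m S.
    have uSB : S *m B \in unitmx by rewrite unitmx_mul uS.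
    apply: (can_inj (mulKmx uSB)); rewrite mulmxV // -mulmxA mulKVmx //.
  exact: cvg_mulmx cB' cS.
exists (fun t => S *m A_ t) => [t|].
  rewrite /preserves trmx_mul St -!mulmxA [S *m (diag_mx _ *m _)]mulmxA Sd -mulmxA.
  by rewrite (mulmxA S S) SS mul1mx mulmxA oA.
rewrite -[B]mul1mx -SS -mulmxA; exact: cvg_mulmx cS cA.
Qed.

End OrthogonalApproximation.

(** * Restriction to the kernel of a diagonal form *)

Lemma diag_unitP (R : realType) n (d : 'rV[R]_n) :
  diag_mx d \in unitmx <-> forall i, d 0 i != 0.
Proof.
rewrite unitmxE unitfE det_diag; split=> [/prodf_neq0 d0 i|d0]; first exact: d0.
by apply/prodf_neq0 => i _.
Qed.

Lemma invmx_diag (R : realType) n (d : 'rV[R]_n) : diag_mx d \in unitmx ->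
  invmx (diag_mx d) = diag_mx (\row_i (d 0 i)^-1).
Proof.
move=> ud; apply: (can_inj (mulKmx ud)); rewrite mulmxV // mulmx_diag.
apply/matrixP => i j; rewrite !mxE mulfV //; exact: (diag_unitP d).1.
Qed.

Section Selection.
Variables (R : realType) (m n : nat) (f : 'I_m -> 'I_n).
Hypothesis f_inj : injective f.

(** Left multiplication by this matrix selects the rows f 0, f 1, ...; the
    submatrix of A on these coordinates is [selmx *m A *m selmx^T]. *)
Definition selmx : 'M[R]_(m, n) := \matrix_(i, j) (f i == j)%:R.
Local Notation S := selmx.

Lemma mul_selmx p (A : 'M[R]_(n, p)) : S *m A = \matrix_(i, j) A (f i) j.
Proof.
apply/matrixP => i j; rewrite !mxE (bigD1 (f i)) //= big1 ?addr0.
  by rewrite mxE eqxx mul1r.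
by move=> k kfi; rewrite mxE eq_sym (negPf kfi) mul0r.
Qed.

Lemma mul_tr_selmx p (A : 'M[R]_(p, n)) : A *m S^T = \matrix_(i, j) A i (f j).
Proof.
apply: trmx_inj; rewrite trmx_mul trmxK mul_selmx.
by apply/matrixP => i j; rewrite !mxE.
Qed.

Lemma selmxK : S *m S^T = 1%:M.
Proof.
by rewrite mul_selmx; apply/matrixP => i j; rewrite !mxE (inj_eq f_inj) eq_sym.
Qed.

Lemma selmx_diag (d : 'rV[R]_n) :
  S *m diag_mx d = diag_mx (d *m S^T) *m S.
Proof.
rewrite mul_selmx mul_tr_selmx mul_diag_mx; apply/matrixP => i j; rewrite !mxE.
by case: eqP => [->|_]; rewrite ?mulr1 ?mulr0.
Qed.

Lemma diag_tr_selmx (d : 'rV[R]_n) :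
  diag_mx d *m S^T = S^T *m diag_mx (d *m S^T).
Proof.
by apply: trmx_inj; rewrite !trmx_mul !tr_diag_mx trmxK selmx_diag.
Qed.

Lemma sel_unit (d : 'rV[R]_n) :
  diag_mx d \in unitmx -> diag_mx (d *m S^T) \in unitmx.
Proof.
by move=> /diag_unitP ud; apply/diag_unitP => i; rewrite mul_tr_selmx mxE.
Qed.

Lemma sel_form_adjoint (d : 'rV[R]_n) A : diag_mx d \in unitmx ->
  form_adjoint (d *m S^T) (S *m A *m S^T) = S *m form_adjoint d A *m S^T.
Proof.
move=> ud; rewrite /form_adjoint !trmx_mul trmxK.
have uE := sel_unit ud.
have -> : S *m (invmx (diag_mx d) *m A^T *m diag_mx d) =
          invmx (diag_mx (d *m S^T)) *m S *m A^T *m diag_mx d.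
  rewrite !mulmxA; congr (_ *m _ *m _); apply: (can_inj (mulKmx uE)).
  by rewrite mulKVmx // mulmxA -selmx_diag mulmxK.
by rewrite -!mulmxA diag_tr_selmx.
Qed.

Lemma form_adjoint_sel (d : 'rV[R]_n) h : diag_mx d \in unitmx ->
  form_adjoint d (S^T *m h *m S) = S^T *m form_adjoint (d *m S^T) h *m S.
Proof.
move=> ud; rewrite /form_adjoint !trmx_mul trmxK.
have uE := sel_unit ud.
have -> : S^T *m (invmx (diag_mx (d *m S^T)) *m h^T *m diag_mx (d *m S^T)) =
          invmx (diag_mx d) *m S^T *m h^T *m diag_mx (d *m S^T).
  rewrite !mulmxA; congr (_ *m _ *m _); apply: (can_inj (mulKmx ud)).
  by rewrite mulKVmx // mulmxA diag_tr_selmx mulmxK.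
by rewrite -!mulmxA selmx_diag.
Qed.

Variable v : 'rV[R]_n.
Hypothesis vP : forall i, (v 0 i == 0) = (i \in codom f).
Local Notation P := (S^T *m S).
Local Notation Q := (1%:M - S^T *m S).
Local Notation V := (diag_mx v).

Lemma degenerate_diag_sel : V *m S^T = 0.
Proof.
rewrite mul_tr_selmx; apply/matrixP => i j; rewrite !mxE.
case: eqP => [->|_] //; rewrite mulr1n; apply/eqP.
by rewrite vP codom_f.
Qed.

Lemma codiag_sel : Q = diag_mx (\row_i (v 0 i)^-1) *m V.
Proof.
rewrite mulmx_diag; apply/matrixP => i j; rewrite !mxE.
have -> : \sum_k S^T i k * S k j = ((i == j) && (i \in codom f))%:R.
  have [/codomP[l ->]|ni] := boolP (i \in codom f); last first.
    rewrite andbF big1 // => k _; rewrite !mxE.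
    by case: eqP => [fi|_]; rewrite ?mul0r //; rewrite -fi codom_f in ni.
  rewrite (bigD1 l) //= big1 => [|k kl]; rewrite !mxE.
    by rewrite eqxx mul1r addr0 andbT.
  by rewrite (inj_eq f_inj) (negPf kl) mul0r.
case: (i == j); rewrite /= ?subr0 // ?mulr0n // -vP.
by have [->|v0] := eqVneq (v 0 i) 0; rewrite ?mulr0 ?subrr // mulVf // subr0.
Qed.

Lemma codiag_mul_sel : Q *m S^T = 0.
Proof. by rewrite mulmxBl mul1mx -mulmxA selmxK mulmx1 subrr. Qed.

Lemma sel_mul_codiag : S *m Q = 0.
Proof. by rewrite mulmxBr mulmx1 mulmxA selmxK mul1mx subrr. Qed.

Lemma diag_codiag_comm (d : 'rV[R]_n) : diag_mx d *m Q = Q *m diag_mx d.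
Proof.
by rewrite mulmxBl mulmxBr mul1mx mulmx1 mulmxA diag_tr_selmx -!mulmxA selmx_diag.
Qed.

Lemma trmx_proj : P^T = P.
Proof. by rewrite trmx_mul trmxK. Qed.

(** A^T V A = V gives V A = A^-T V, which kills the kernel of V. *)
Lemma stab_upper0 A : A \in unitmx -> preserves v A -> Q *m A *m S^T = 0.
Proof.
move=> uA AV; rewrite codiag_sel -!mulmxA [V *m _]mulmxA.
have -> : V *m A = invmx A^T *m V.
  by rewrite -{2}AV -!mulmxA mulKmx ?unitmx_tr.
by rewrite -mulmxA degenerate_diag_sel !mulmx0.
Qed.

Lemma stab_sel A : A \in unitmx -> preserves v A ->
  A *m S^T = S^T *m (S *m A *m S^T).
Proof.
move=> uA AV; apply/eqP; rewrite -subr_eq0 !mulmxA.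
by rewrite -{1}[A]mul1mx -!mulmxBl stab_upper0.
Qed.

Lemma stab_selM A B : A \in unitmx -> preserves v A ->
  S *m (B *m A) *m S^T = (S *m B *m S^T) *m (S *m A *m S^T).
Proof.
move=> uA AV; rewrite [S *m (B *m A)]mulmxA -[_ *m A *m S^T]mulmxA.
by rewrite (stab_sel uA AV) !mulmxA.
Qed.

Lemma stab_sel_inv A : A \in unitmx -> preserves v A ->
  (S *m invmx A *m S^T) *m (S *m A *m S^T) = 1%:M.
Proof.
by move=> uA AV; rewrite -stab_selM // mulVmx // mulmx1 selmxK.
Qed.

Lemma stab_sel_unit A : A \in unitmx -> preserves v A ->
  S *m A *m S^T \in unitmx.
Proof. by move=> uA AV; have [] := mulmx1_unit (stab_sel_inv uA AV). Qed.

Lemma stab_sel_invE A : A \in unitmx -> preserves v A ->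
  S *m invmx A *m S^T = invmx (S *m A *m S^T).
Proof.
move=> uA AV; have uh := stab_sel_unit uA AV.
by rewrite -[LHS](mulmxK uh) stab_sel_inv // mul1mx.
Qed.

Variables (T : Type) (F : set_system T).
Context {FF : ProperFilter F}.

Lemma cvg_preserves (d_ : T -> 'rV[R]_n) (A_ : T -> 'M[R]_n) (w : 'rV[R]_n)
    (A : 'M[R]_n) :
  d_ t @[t --> F] --> w -> A_ t @[t --> F] --> A ->
  (forall t, preserves (d_ t) (A_ t)) -> preserves w A.
Proof.
move=> cd cA dA.
have c1 : (A_ t)^T *m diag_mx (d_ t) *m A_ t @[t --> F] --> A^T *m diag_mx w *m A.
  exact: cvg_mulmx (cvg_mulmx (cvg_trmx cA) (cvg_diag_mx cd)) cA.
have c2 : (A_ t)^T *m diag_mx (d_ t) *m A_ t @[t --> F] --> diag_mx w.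
  by under eq_fun do rewrite dA; exact: cvg_diag_mx.
exact: mx_cvg_unique c1 c2.
Qed.

(** The adjoint of the selected block of A_t is the selected block of the adjoint
    A_t^-1, and it tends to the inverse of the block of A because A is block
    triangular. *)
Lemma cvg_block (d_ : T -> 'rV[R]_n) (A_ : T -> 'M[R]_n) (A : 'M[R]_n) :
  (forall t, diag_mx (d_ t) \in unitmx) ->
  d_ t @[t --> F] --> v -> A_ t @[t --> F] --> A -> A \in unitmx ->
  (forall t, preserves (d_ t) (A_ t)) ->
  exists2 h_ : T -> 'M[R]_m,
    forall t, preserves (d_ t *m S^T) (h_ t) &
    h_ t @[t --> F] --> S *m A *m S^T.
Proof.
move=> ud cd cA uA dA; have AV := cvg_preserves cd cA dA.
have cS : S @[t --> F] --> S by exact: cvg_cst.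
have cSt : S^T @[t --> F] --> S^T by exact: cvg_cst.
apply: (@orthogonal_approx R T F _ m (fun t => d_ t *m S^T)
          (fun t => S *m A_ t *m S^T)).
- by move=> t; exact: sel_unit.
- exact: cvg_mulmx (cvg_mulmx cS cA) cSt.
- exact: stab_sel_unit.
- rewrite -stab_sel_invE //.
  have E t : form_adjoint (d_ t *m S^T) (S *m A_ t *m S^T) =
             S *m invmx (A_ t) *m S^T.
    by rewrite sel_form_adjoint // form_adjoint_preserves.
  under eq_fun do rewrite E.
  exact: cvg_mulmx (cvg_mulmx cS (cvg_invmx cA uA)) cSt.
Qed.

(** The approximation B_t agrees with A on the columns in the support of v and
    has h_t as kernel block.  The remaining block is zero in A; in B_t it is the
    corresponding block of the D_t-adjoint of A^-1, which tends to zero.  With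
    this choice the matching block of the adjoint of B_t is that of A^-1, although
    the kernel block of D_t^-1 diverges. *)
Lemma cvg_lift (d_ : T -> 'rV[R]_n) (h_ : T -> 'M[R]_m) (A : 'M[R]_n) :
  (forall t, diag_mx (d_ t) \in unitmx) ->
  d_ t @[t --> F] --> v -> A \in unitmx -> preserves v A ->
  (forall t, preserves (d_ t *m S^T) (h_ t)) ->
  h_ t @[t --> F] --> S *m A *m S^T ->
  exists2 A_ : T -> 'M[R]_n,
    forall t, preserves (d_ t) (A_ t) & A_ t @[t --> F] --> A.
Proof.
move=> ud cd uA AV dh ch.
have cc p q (M : 'M[R]_(p, q)) : M @[t --> F] --> M by exact: cvg_cst.
have uh := stab_sel_unit uA AV.
(* On the support of v the inverses of the coordinates of d_t converge; on the
   kernel both sides vanish, since 0^-1 = 0. *)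
have cQd : Q *m invmx (diag_mx (d_ t)) @[t --> F] -->
           diag_mx (\row_i (v 0 i)^-1).
  have -> : diag_mx (\row_i (v 0 i)^-1) =
            Q *m diag_mx (\row_i (v 0 i)^-1).
    rewrite codiag_sel !mulmx_diag; congr diag_mx; apply/rowP => i; rewrite !mxE.
    by have [->|v0] := eqVneq (v 0 i) 0; rewrite ?invr0 ?mul0r // mulVf ?mul1r.
  under eq_fun do rewrite invmx_diag // codiag_sel mulmx_diag mulmx_diag.
  rewrite codiag_sel !mulmx_diag; apply: cvg_diag_mx; apply/mx_cvgP => i j.
  rewrite !mxE; under eq_fun do rewrite !mxE.
  have [v0|v0] := eqVneq (v 0 j) 0.
    by rewrite v0 mulr0 !mul0r; under eq_fun do rewrite mul0r; exact: cvg_cst.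
  apply: cvgM; first exact: cvg_cst.
  by apply: cvgV => //; exact: (mx_cvgP _ _).1 cd 0 j.
pose V' := diag_mx (\row_i (v 0 i)^-1).
apply: (@orthogonal_approx R T F _ n d_ (fun t =>
  A *m Q + Q *m form_adjoint (d_ t) (invmx A) *m P + S^T *m h_ t *m S)) => //.
- have eA : A = A *m Q + V' *m (invmx A)^T *m (V *m P)
                   + S^T *m (S *m A *m S^T) *m S.
    rewrite [V *m P]mulmxA degenerate_diag_sel mul0mx mulmx0 addr0.
    by rewrite -stab_sel // -[A *m S^T *m S]mulmxA -mulmxDr subrK mulmx1.
  rewrite [X in _ --> X]eA.
  have E t : Q *m form_adjoint (d_ t) (invmx A) *m P =
      (Q *m invmx (diag_mx (d_ t))) *m (invmx A)^T *m (diag_mx (d_ t) *m P).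
    by rewrite /form_adjoint !mulmxA.
  under eq_fun do rewrite E.
  have c2 : S^T *m h_ t *m S @[t --> F] --> S^T *m (S *m A *m S^T) *m S.
    exact: cvg_mulmx (cvg_mulmx (cc _ _ S^T) ch) (cc _ _ S).
  apply: (cvg_addmx (cvg_addmx (cc _ _ (A *m Q)) _) c2).
  exact: cvg_mulmx (cvg_mulmx cQd (cc _ _ _)) (cvg_mulmx (cvg_diag_mx cd) (cc _ _ _)).
- have eA : invmx A = V' *m A^T *m V + P *m invmx A *m Q
                      + S^T *m invmx (S *m A *m S^T) *m S.
    have -> : V' *m A^T *m V = Q *m invmx A.
      apply: (can_inj (mulmxK uA)); rewrite mulmxKV // -!mulmxA.
      by rewrite [_ *m (V *m A)]mulmxA AV -codiag_sel.
    rewrite -stab_sel_invE // addrAC -!addrA.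
    have -> : S^T *m (S *m invmx A *m S^T) *m S = P *m invmx A *m P.
      by rewrite !mulmxA.
    by rewrite -mulmxDr [P + _]addrC subrK mulmx1 -mulmxDl subrK mul1mx.
  rewrite [X in _ --> X]eA.
  have Qt : Q^T = Q by rewrite linearB /= trmx1 trmx_proj.
  have aQ t : form_adjoint (d_ t) Q = Q.
    by rewrite /form_adjoint Qt -mulmxA -diag_codiag_comm mulKmx.
  have aP t : form_adjoint (d_ t) P = P.
    by rewrite -[S^T]mulmx1 form_adjoint_sel // form_adjoint1 // sel_unit.
  have E t : form_adjoint (d_ t)
      (A *m Q + Q *m form_adjoint (d_ t) (invmx A) *m P + S^T *m h_ t *m S) =
    (Q *m invmx (diag_mx (d_ t))) *m A^T *m diag_mx (d_ t)
    + P *m invmx A *m Q + S^T *m invmx (h_ t) *m S.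
    rewrite !form_adjointD (form_adjointM A) // (form_adjointM _ P) //.
    rewrite (form_adjointM Q) // aQ aP form_adjointK //.
    rewrite form_adjoint_sel // (form_adjoint_preserves (sel_unit (ud t)) (dh t)).
    by rewrite /form_adjoint !mulmxA.
  under eq_fun do rewrite E.
  have c2 : S^T *m invmx (h_ t) *m S @[t --> F] -->
            S^T *m invmx (S *m A *m S^T) *m S.
    exact: cvg_mulmx (cvg_mulmx (cc _ _ S^T) (cvg_invmx ch uh)) (cc _ _ S).
  apply: (cvg_addmx (cvg_addmx _ (cc _ _ (P *m invmx A *m Q))) c2).
  exact: cvg_mulmx (cvg_mulmx cQd (cc _ _ _)) (cvg_diag_mx cd).
Qed.

(** This is diag(1, h), the matrix acting by h on the selected coordinates and
    fixing the others. *)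
Definition section_mx (h : 'M[R]_m) : 'M[R]_n := S^T *m h *m S + Q.

Lemma section_mxM g h : section_mx (g *m h) = section_mx g *m section_mx h.
Proof.
rewrite /section_mx mulmxDl (mulmxDr (S^T *m g *m S)) (mulmxDr Q).
have -> : S^T *m g *m S *m (S^T *m h *m S) = S^T *m (g *m h) *m S.
  by rewrite -!mulmxA (mulmxA S) selmxK mul1mx.
have -> : S^T *m g *m S *m Q = 0 by rewrite -!mulmxA sel_mul_codiag !mulmx0.
have -> : Q *m (S^T *m h *m S) = 0 by rewrite !mulmxA codiag_mul_sel !mul0mx.
have -> : Q *m Q = Q.
  by rewrite mulmxBl mul1mx -[P *m Q]mulmxA sel_mul_codiag mulmx0 subr0.
by rewrite addr0 add0r.
Qed.

Lemma section_mx1 : section_mx 1%:M = 1%:M.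
Proof. by rewrite /section_mx mulmx1 addrC subrK. Qed.

Lemma section_mx_unit h : h \in unitmx -> section_mx h \in unitmx.
Proof.
move=> uh; have := section_mxM h (invmx h).
by rewrite mulmxV // section_mx1 => /esym/mulmx1_unit[].
Qed.

Lemma sel_section_mx h : S *m section_mx h *m S^T = h.
Proof.
rewrite mulmxDr mulmxDl sel_mul_codiag mul0mx addr0.
by rewrite !mulmxA selmxK mul1mx -mulmxA selmxK mulmx1.
Qed.

Lemma section_preserves (d : 'rV[R]_n) h :
  preserves (d *m S^T) h -> preserves d (section_mx h).
Proof.
rewrite /preserves /section_mx => hE.
have Qt : Q^T = Q by rewrite linearB /= trmx1 trmx_proj.
rewrite [(S^T *m h *m S + Q)^T]linearD /= Qt !trmx_mul trmxK -mulmxA mulmxDr.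
have -> : diag_mx d *m (S^T *m h *m S) =
          S^T *m diag_mx (d *m S^T) *m h *m S by rewrite !mulmxA diag_tr_selmx.
rewrite mulmxDl (mulmxDr (S^T *m _)) (mulmxDr Q).
have -> : S^T *m (h^T *m S) *m (S^T *m diag_mx (d *m S^T) *m h *m S) =
          diag_mx d *m P.
  rewrite -!mulmxA [S *m (S^T *m _)]mulmxA selmxK mul1mx.
  rewrite [diag_mx (d *m _) *m (_ *m _)]mulmxA [h^T *m _]mulmxA.
  by rewrite [h^T *m (_ *m _)]mulmxA hE !mulmxA diag_tr_selmx.
have -> : S^T *m (h^T *m S) *m (diag_mx d *m Q) = 0.
  by rewrite diag_codiag_comm -!mulmxA [S *m (Q *m _)]mulmxA sel_mul_codiag
     mul0mx !mulmx0.
have -> : Q *m (S^T *m diag_mx (d *m S^T) *m h *m S) = 0.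
  by rewrite !mulmxA codiag_mul_sel !mul0mx.
have -> : Q *m (diag_mx d *m Q) = diag_mx d *m Q.
  rewrite mulmxA -diag_codiag_comm -mulmxA; congr (_ *m _).
  by rewrite mulmxBl mul1mx -[P *m Q]mulmxA sel_mul_codiag mulmx0 subr0.
by rewrite addr0 add0r -mulmxDr addrC subrK mulmx1.
Qed.

Lemma section_stab h : preserves v (section_mx h).
Proof.
apply: section_preserves; rewrite /preserves.
have -> : v *m S^T = 0.
  rewrite mul_tr_selmx; apply/rowP => j; rewrite !mxE.
  by apply/eqP; rewrite vP codom_f.
by rewrite linear0 mulmx0 mul0mx.
Qed.

End Selection.

(** * Convergence in the Chabauty topology *)

Section Chabauty.
Variable G : preTopologicalGroupType.
Implicit Types (H : closed_subgroup G) (K U : set G).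

Lemma closed_subgroup_eq (H H' : closed_subgroup G) :
  (forall x, subgroup_set H x <-> subgroup_set H' x) -> H = H'.
Proof.
case: H H' => [h c1 c2 c3 c4] [h' c1' c2' c3' c4'] /= hh'.
have e : h = h' by apply/seteqP; split=> x /hh'.
by rewrite e in c1 c2 c3 c4 *; congr ClosedSubgroup; exact: Prop_irrelevance.
Qed.

Lemma chabauty_subbase_open A :
  chabauty_subbase A -> open (A : set (closed_subgroup G)).
Proof.
move=> sA; exists [set A]; last by rewrite bigcup_set1.
move=> _ ->; exists [fset A]%fset.
  by move=> B /fset1P ->; apply/mem_set.
by rewrite set_fset1 bigcap_set1.
Qed.

Lemma chabauty_miss_open K : compact K -> open (chabauty_miss K).
Proof. by move=> cK; apply: chabauty_subbase_open; left; exists K. Qed.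

Lemma chabauty_hit_open U : open U -> open (chabauty_hit U).
Proof. by move=> oU; apply: chabauty_subbase_open; right; exists U. Qed.

Lemma chabauty_cvgP (T : Type) (F : set_system T) {FF : Filter F}
    (H_ : T -> closed_subgroup G) H :
  H_ t @[t --> F] --> H <->
  (forall K, compact K -> chabauty_miss K H ->
     \forall t \near F, chabauty_miss K (H_ t)) /\
  (forall U, open U -> chabauty_hit U H ->
     \forall t \near F, chabauty_hit U (H_ t)).
Proof.
split=> [cH|[mH hH]].
  split=> A pA HA; apply: cH; apply: open_nbhs_nbhs; split=> //.
    exact: chabauty_miss_open.
  exact: chabauty_hit_open.
move=> A; rewrite nbhsE => -[B [[D sD <-] [C DC HC]] BA].
have [E sE CE] := sD C DC.
rewrite /nbhs /=.
suff : \forall t \near F, C (H_ t).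
  by apply: filterS => t Ct; apply: BA; exists C.
rewrite -CE.
have : \forall t \near F, forall i : E, (val i) (H_ t).
  apply: filter_forall => -[i iE] /=.
  have Hi : i H by rewrite -CE in HC; exact: HC.
  have := sE i iE; rewrite inE => -[[K cK Ki]|[U oU Ui]].
    by rewrite -Ki in Hi *; exact: mH.
  by rewrite -Ui in Hi *; exact: hH.
by apply: filterS => t Et i /= iE; exact: (Et [` iE]%fset).
Qed.

End Chabauty.

(** * Sequences of closed subgroups of the general linear group *)

Section Cubes.
Variables (R : realType) (m n : nat).
Implicit Types M N : 'M[R]_(m, n).

(** The balls of the pseudometric on matrices are open; compactness needs the
    closed ones. *)
Definition cube e M : set 'M[R]_(m, n) :=
  [set N | forall i j, `|N i j - M i j| <= e].

Lemma cube_nbhs e M : 0 < e -> nbhs M (cube e M).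
Proof.
move=> e0; exists (fun i j => [set x | `|x - M i j| <= e]) => // i j.
have := @nbhsx_ballx R R (M i j) _ e0.
by apply: filterS => x; rewrite -ball_normE /= distrC => /ltW.
Qed.

Lemma nbhs_cube M A : nbhs M A -> exists j, cube j.+1%:R^-1 M `<=` A.
Proof.
move=> [P nP PA].
have : \forall k \near \oo, forall i j,
    [set x : R | `|x - M i j| <= k.+1%:R^-1] `<=` P i j.
  apply: filter_forall => i; apply: filter_forall => j.
  have /nbhs_ballP[e /= e0 eP] := nP i j.
  have := near_infty_natSinv_lt (PosNum e0).
  apply: filterS => k ke x /= xk; apply: eP; rewrite -ball_normE /= distrC.
  exact: le_lt_trans ke.
move=> /filter_ex[k kP]; exists k => N NM; apply: PA => i j; apply: kP; exact: NM.
Qed.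

Lemma cube_compact e M : compact (cube e M).
Proof.
pose I k := `[mxvec M 0 k - e, mxvec M 0 k + e]%classic : set R.
pose B : set 'rV[R]_(m * n) := [set v | forall k, I k (v ord0 k)].
have cB : compact B by apply: rV_compact => k; exact: segment_compact.
have -> : cube e M = vec_mx @` B.
  apply/seteqP; split=> [N NM|_ [v Bv <-] i j].
    exists (mxvec N); last exact: mxvecK.
    move=> k; case/mxvec_indexP: k => i j; rewrite /I /= !mxvecE in_itv /=.
    by have := NM i j; rewrite ler_distl.
  have := Bv (mxvec_index i j); rewrite /I /= mxvecE in_itv /= mxE.
  by rewrite ler_distl.
apply: continuous_compact => //; apply: continuous_subspaceT => v.
apply/(@mx_cvgP R _ (nbhs v) (nbhs_filter v)) => i j; rewrite mxE.
by under eq_fun do rewrite mxE; exact: coord_continuous.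
Qed.

Lemma cvg_cube (M_ : nat -> 'M[R]_(m, n)) M :
  (forall t, cube t.+1%:R^-1 M (M_ t)) -> M_ t @[t --> \oo] --> M.
Proof.
move=> cM; apply/mx_cvgP => i j; apply/cvgrPdist_lt => e e0.
have := near_infty_natSinv_lt (PosNum e0); apply: filterS => k ke.
by rewrite distrC; apply: le_lt_trans ke; exact: cM.
Qed.

Lemma cube_le e e' M : e <= e' -> cube e M `<=` cube e' M.
Proof. by move=> ee' N NM i j; exact: le_trans ee'. Qed.

End Cubes.

Section SetType.
Variables (X : topologicalType) (A : set X).

Lemma cvg_set_type (T : Type) (F : set_system T) {FF : Filter F}
    (u : T -> set_type A) (x : set_type A) :
  u t @[t --> F] --> x <-> set_val (u t) @[t --> F] --> set_val x.
Proof.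
split=> [cu|cu B].
  exact: continuous_cvg (@initial_continuous _ _ set_val x) cu.
rewrite nbhsE => -[C [[D oD DC] Cx] CB].
have nD : nbhs (set_val x) D.
  by apply: open_nbhs_nbhs; split=> //; rewrite -DC in Cx.
have : \forall t \near F, D (set_val (u t)) := cu D nD.
rewrite /nbhs /=; apply: filterS => t Dt; apply: CB; rewrite -DC; exact: Dt.
Qed.

Lemma continuous_set_type (T : topologicalType) (u : T -> set_type A) :
  continuous (fun t => set_val (u t)) -> continuous u.
Proof. by move=> cu t; apply/(@cvg_set_type T (nbhs t)); exact: cu. Qed.

End SetType.

Section GLTopology.
Variables (R : realType) (n : nat).
Local Notation GL := (GL R n).

Lemma GL_cvg (T : Type) (F : set_system T) {FF : Filter F} (u : T -> GL) (x : GL) :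
  u t @[t --> F] --> x <-> GLmx (u t) @[t --> F] --> GLmx x.
Proof. exact: (@cvg_set_type _ _ T F). Qed.

Lemma GL_nbhsP (x : GL) (U : set GL) :
  nbhs x U <-> exists2 V, nbhs (GLmx x) V & (@GLmx R n) @^-1` V `<=` U.
Proof.
split=> [|[V nV VU]]; last first.
  by apply: filterS VU _; exact: (@GLmx_continuous R n x).
rewrite nbhsE => -[B [[D oD DB] Bx] BU]; exists D; last first.
  by move=> y Dy; apply: BU; rewrite -DB; exact: Dy.
by apply: open_nbhs_nbhs; split=> //; rewrite -DB in Bx.
Qed.

Lemma GL_compact (C : set 'M[R]_n) : compact C ->
  (forall M, C M -> M \in unitmx) -> compact ((@GLmx R n) @^-1` C).
Proof.
move=> cC uC F PF FC.
have [M [CM clM]] := cC ((@GLmx R n) @ F) _ FC.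
exists (GLmk (uC M CM)); split; first by rewrite /= GLmxK.
move=> A B FA /GL_nbhsP[V]; rewrite GLmxK => nV VB.
have FA' : \forall x \near F, ((@GLmx R n) @` A) (GLmx x).
  by apply: filterS FA => x Ax; exists x.
have [_ [[x Ax <-] Vx]] := clM _ V FA' nV.
by exists x; split=> //; exact: VB.
Qed.

Definition GLcube e (x : GL) : set GL := (@GLmx R n) @^-1` cube e (GLmx x).

Lemma GLcube_nbhs e (x : GL) : 0 < e -> nbhs x (GLcube e x).
Proof.
by move=> e0; apply/GL_nbhsP; exists (cube e (GLmx x)) => //; exact: cube_nbhs.
Qed.

Lemma nbhs_GLcube (x : GL) (U : set GL) : nbhs x U ->
  exists j, GLcube j.+1%:R^-1 x `<=` U.
Proof.
by move=> /GL_nbhsP[V /nbhs_cube[j jV] VU]; exists j => y /jV; exact: VU.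
Qed.

Lemma unitmx_nbhs (M : 'M[R]_n) :
  M \in unitmx -> nbhs M [set N : 'M[R]_n | N \in unitmx].
Proof. by move=> uM; apply: (@near_unitmx R _ (nbhs M) _ n id M). Qed.

Lemma GL_compact_nbhs (x : GL) (U : set GL) : nbhs x U ->
  exists K, [/\ compact K, nbhs x K & K `<=` U].
Proof.
move=> /GL_nbhsP[V nV VU].
have nW : nbhs (GLmx x) (V `&` [set N : 'M[R]_n | N \in unitmx]).
  by apply: filterI => //; exact/unitmx_nbhs/GLmx_unit.
have [j jW] := nbhs_cube nW.
exists (GLcube j.+1%:R^-1 x); split.
- by apply: GL_compact; [exact: cube_compact | move=> M /jW[]].
- by apply: GLcube_nbhs; rewrite invr_gt0.
- by move=> y /jW[Vy _]; exact: VU.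
Qed.

Lemma GLcube_shrink (x : GL) j k : (j <= k)%N ->
  GLcube k.+1%:R^-1 x `<=` GLcube j.+1%:R^-1 x.
Proof.
move=> jk y; apply: cube_le.
by rewrite lef_pV2 ?posrE // ler_nat ltnS.
Qed.

Implicit Types (H : closed_subgroup GL).

(** Together with [chabauty_cvg_limit] and its converse [chabauty_cvg_seq], this
    is the description of Chabauty convergence as Kuratowski convergence. *)
Lemma chabauty_cvg_approx (H_ : nat -> closed_subgroup GL) H :
  H_ t @[t --> \oo] --> H -> forall x, subgroup_set H x ->
  exists2 x_ : nat -> GL, forall t, subgroup_set (H_ t) (x_ t) &
    GLmx (x_ t) @[t --> \oo] --> GLmx x.
Proof.
move=> /chabauty_cvgP[_ hH] x Hx.
(* x_ t lies in the smallest cube around x, among the first t ones, that meets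
   H_ t. *)
pose good t j := exists2 y, subgroup_set (H_ t) y & GLcube j.+1%:R^-1 x y.
have ex t N : exists y, subgroup_set (H_ t) y /\
    forall j, (j < N)%N -> good t j -> GLcube j.+1%:R^-1 x y.
  elim: N => [|N [y [Hy yN]]].
    by exists 1%g; split=> //; exact: closed_subgroup1.
  have [[z Hz zN]|nN] := pselect (good t N).
    by exists z; split=> // j; rewrite ltnS => jN _; exact: GLcube_shrink zN.
  exists y; split=> // j; rewrite ltnS leq_eqVlt => /orP[/eqP -> //|jN].
  exact: yN.
have /choice[x_ xP] : forall t, exists y, subgroup_set (H_ t) y /\
    forall j, (j < t)%N -> good t j -> GLcube j.+1%:R^-1 x y by move=> t; exact: ex.
exists x_ => [t|]; first by have [] := xP t.
apply/GL_cvg => U nU; have [j jU] := nbhs_GLcube nU.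
have : \forall t \near \oo, chabauty_hit (GLcube j.+1%:R^-1 x)° (H_ t).
  apply: hH; first exact: open_interior.
  by exists x; split=> //; apply: GLcube_nbhs; rewrite invr_gt0.
move=> hj; rewrite /nbhs /=.
apply: filterS (filterI hj (nbhs_infty_gt j)) => t [[y [Hy yj]] jt].
apply: jU; have [_] := xP t; apply=> //.
by exists y => //; exact: interior_subset.
Qed.

Lemma chabauty_cvg_limit (H_ : nat -> closed_subgroup GL) H :
  H_ t @[t --> \oo] --> H ->
  forall (phi : nat -> nat) (x_ : nat -> GL) (x : GL),
    phi j @[j --> \oo] --> \oo ->
    (forall j, subgroup_set (H_ (phi j)) (x_ j)) ->
    GLmx (x_ j) @[j --> \oo] --> GLmx x -> subgroup_set H x.
Proof.
move=> /chabauty_cvgP[mH _] phi x_ x cphi Hx /GL_cvg cx; apply: contrapT => nHx.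
have nH : nbhs x (~` subgroup_set H).
  apply: open_nbhs_nbhs; split=> //.
  by apply: closed_openC; exact: closed_subgroup_closed.
have [K [cK nK KH]] := GL_compact_nbhs nH.
have : \forall t \near \oo, chabauty_miss K (H_ t).
  by apply: mH => //; apply/seteqP; split=> // y [Hy /KH].
move=> /cphi mK.
have [j [mj xj]] : exists j, chabauty_miss K (H_ (phi j)) /\ K (x_ j).
  by apply: (@filter_ex _ \oo); apply: filterI; [exact: mK | exact: cx].
have : (subgroup_set (H_ (phi j)) `&` K) (x_ j) by split.
by rewrite mj.
Qed.

Lemma chabauty_cvg_seq (H_ : nat -> closed_subgroup GL) H :
  (forall x, subgroup_set H x ->
    exists2 x_ : nat -> GL, forall t, subgroup_set (H_ t) (x_ t) &
      GLmx (x_ t) @[t --> \oo] --> GLmx x) ->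
  (forall (phi : nat -> nat) (x_ : nat -> GL) (x : GL),
    phi j @[j --> \oo] --> \oo ->
    (forall j, subgroup_set (H_ (phi j)) (x_ j)) ->
    GLmx (x_ j) @[j --> \oo] --> GLmx x -> subgroup_set H x) ->
  H_ t @[t --> \oo] --> H.
Proof.
move=> approx limit; apply/chabauty_cvgP; split=> [K cK mK|U oU [x [Hx Ux]]].
  suff : \forall t \near \oo, K `<=` [set x | ~ subgroup_set (H_ t) x].
    by apply: filterS => t Kt; apply/seteqP; split=> // y [Hy /Kt].
  move/compact_near_coveringP : cK; apply => x Kx.
  apply: contrapT => nx.
  have nHx : ~ subgroup_set H x.
    by move=> Hx; have : (subgroup_set H `&` K) x by []; rewrite mK.
  have /choice[s sP] : forall j, exists s : nat * GL,
      [/\ (j <= s.1)%N, subgroup_set (H_ s.1) s.2 & GLcube j.+1%:R^-1 x s.2].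
    move=> j; apply: contrapT => nj; apply: nx.
    exists (GLcube j.+1%:R^-1 x, [set t | (j <= t)%N]) => /=.
      by split; [apply: GLcube_nbhs; rewrite invr_gt0 | exact: nbhs_infty_ge].
    by move=> [y t] [/= yx jt] Hy; apply: nj; exists (t, y).
  apply: nHx; apply: (limit (fst \o s) (snd \o s)).
  - move=> A [N _ NA]; exists N => // j /= Nj; apply: NA => /=.
    by have [js _ _] := sP j; exact: leq_trans js.
  - by move=> j; have [] := sP j.
  - by apply: cvg_cube => j; have [] := sP j.
have [x_ Hx_ /GL_cvg cx] := approx x Hx.
have nU : nbhs x U by exact: open_nbhs_nbhs.
have : \forall t \near \oo, U (x_ t) := cx U nU.
by apply: filterS => t Ut; exists (x_ t).
Qed.

Lemma chabauty_cvg_unique (H_ : nat -> closed_subgroup GL) H H' :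
  H_ t @[t --> \oo] --> H -> H_ t @[t --> \oo] --> H' -> H = H'.
Proof.
have sub K K' : H_ t @[t --> \oo] --> K -> H_ t @[t --> \oo] --> K' ->
    forall x, subgroup_set K x -> subgroup_set K' x.
  move=> cK cK' x Kx; have [x_ Hx cx] := chabauty_cvg_approx cK Kx.
  exact: (chabauty_cvg_limit cK' (phi := id) _ Hx cx).
by move=> cH cH'; apply: closed_subgroup_eq => x; split; exact: sub.
Qed.

End GLTopology.

(** * Closure points of the Chabauty space are limits of sequences *)

Section SequentialClosure.
Variables (R : realType) (n : nat).
Local Notation GL := (GL R n).

(** Those of these cubes that are compact in the general linear group form a
    countable family of compact neighbourhoods that refines every
    neighbourhood. *)
Definition rational_cube (i : 'M[rat]_n * nat) : set GL :=
  (@GLmx R n) @^-1` cube i.2.+1%:R^-1 (map_mx ratr i.1).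

Lemma nbhs_rational_cube (x : GL) (U : set GL) : nbhs x U ->
  exists i, [/\ compact (rational_cube i), nbhs x (rational_cube i) &
                rational_cube i `<=` U].
Proof.
move=> /GL_nbhsP[V nV VU].
have nW : nbhs (GLmx x) (V `&` [set N : 'M[R]_n | N \in unitmx]).
  by apply: filterI => //; exact/unitmx_nbhs/GLmx_unit.
have [k kW] := nbhs_cube nW.
(* The cubes of index l have half the radius of the cube of index k. *)
pose l := k.+1.*2.-1; pose e : R := l.+1%:R^-1.
have e0 : 0 < e by rewrite invr_gt0.
have e2 : e + e = k.+1%:R^-1.
  rewrite /e /l prednK ?double_gt0 // -muln2 natrM invfM -mulrDr.
  by rewrite -[2^-1]div1r -splitr mulr1.
have /choice[q_ qP] : forall ij : 'I_n * 'I_n, exists q : rat,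
    `|GLmx x ij.1 ij.2 - ratr q| < e.
  move=> ij; have [|q] := @rat_in_itvoo R (GLmx x ij.1 ij.2 - e) (GLmx x ij.1 ij.2 + e).
    by rewrite ltrBlDr -addrA ltrDl addr_gt0.
  by rewrite in_itv /= => qe; exists q; rewrite distrC ltr_distl.
pose q : 'M[rat]_n := \matrix_(i, j) q_ (i, j).
have sub : cube e (map_mx ratr q) `<=` cube k.+1%:R^-1 (GLmx x).
  move=> N Ne i j; rewrite -e2.
  have -> : N i j - GLmx x i j = (N i j - map_mx ratr q i j) +
                                 (map_mx ratr q i j - GLmx x i j).
    by rewrite addrA subrK.
  apply: le_trans (ler_normD _ _) _; apply: lerD; first exact: Ne.
  by rewrite !mxE distrC; apply/ltW; exact: (qP (i, j)).
exists (q, l); split.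
- by apply: GL_compact; [exact: cube_compact | move=> M /sub /kW[]].
- apply/GL_nbhsP; exists (cube e (map_mx ratr q)) => //.
  exists (fun i j => [set y | `|y - map_mx ratr q i j| <= e]) => // i j.
  have d0 : 0 < e - `|GLmx x i j - map_mx ratr q i j|.
    by rewrite subr_gt0 !mxE; exact: (qP (i, j)).
  have := @nbhsx_ballx R R (GLmx x i j) _ d0; apply: filterS => y.
  rewrite -ball_normE /= ltrBrDr distrC => yx.
  by apply: ltW; apply: le_lt_trans yx; exact: ler_distD.
- by move=> y /sub /kW[Vy _]; exact: VU.
Qed.

(** Hitting the interiors of rational cubes and missing the compact ones among
    them are countably many conditions; they determine a countable base of
    neighbourhoods of L. *)
Lemma chabauty_closure_seq (A : set (closed_subgroup GL)) L : closure A L ->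
  exists2 H_ : nat -> closed_subgroup GL, forall t, A (H_ t) &
    H_ t @[t --> \oo] --> L.
Proof.
move=> clA.
pose W i : set (closed_subgroup GL) := [set H |
  (chabauty_hit (rational_cube i)° L -> chabauty_hit (rational_cube i)° H) /\
  (compact (rational_cube i) -> chabauty_miss (rational_cube i) L ->
   chabauty_miss (rational_cube i) H)].
have nW i : nbhs L (W i).
  apply: filterI.
    have [hL|nhL] := pselect (chabauty_hit (rational_cube i)° L); last first.
      by apply: filterS filterT => H _ /nhL.
    apply: filterS (_ : nbhs L (chabauty_hit (rational_cube i)°)) => //.
    apply: open_nbhs_nbhs; split=> //.
    by apply: chabauty_hit_open; exact: open_interior.
  have [cK|ncK] := pselect (compact (rational_cube i)); last first.
    by apply: filterS filterT => H _ /ncK.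
  have [mL|nmL] := pselect (chabauty_miss (rational_cube i) L); last first.
    by apply: filterS filterT => H _ _ /nmL.
  apply: filterS (_ : nbhs L (chabauty_miss (rational_cube i))) => //.
  by apply: open_nbhs_nbhs; split=> //; exact: chabauty_miss_open.
have nV j : nbhs L [set H | forall (k : 'I_j.+1) (i : 'M[rat]_n * nat),
    (choice.pickle i = k :> nat) -> W i H].
  have := @filter_forall _ _ (fun k : 'I_j.+1 => [set H | forall i : 'M[rat]_n * nat,
    (choice.pickle i = k :> nat) -> W i H]) (nbhs L) (nbhs_filter L).
  apply => k.
  have [[i ik]|ni] :=
    pselect (exists i : 'M[rat]_n * nat, choice.pickle i = k :> nat); last first.
    by apply: filterS filterT => H _ i ik; exfalso; apply: ni; exists i.
  apply: filterS (nW i) => H WH i' i'k.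
  by have <- : i = i' by apply: (pcan_inj choice.pickleK); rewrite ik i'k.
have /choice[H_ HP] : forall j, exists H, A H /\
    forall (k : 'I_j.+1) (i : 'M[rat]_n * nat),
    (choice.pickle i = k :> nat) -> W i H.
  by move=> j; have [H [AH WH]] := clA _ (nV j); exists H.
have HW i t : (choice.pickle i <= t)%N -> W i (H_ t).
  move=> it.
  by have [_ /(_ (Ordinal (it : choice.pickle i < t.+1)%N) i)] := HP t; exact.
exists H_ => [t|]; first by have [] := HP t.
apply/chabauty_cvgP; split=> [K cK mK|U oU [x [Lx Ux]]].
  suff : \forall t \near \oo, K `<=` [set x | ~ subgroup_set (H_ t) x].
    by apply: filterS => t Kt; apply/seteqP; split=> // y [Hy /Kt].
  move/compact_near_coveringP : cK; apply => x Kx.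
  have nL : nbhs x (~` subgroup_set L).
    apply: open_nbhs_nbhs; split.
      by apply: closed_openC; exact: closed_subgroup_closed.
    by move=> Lx; have : (subgroup_set L `&` K) x by []; rewrite mK.
  have [i [ci ni iL]] := nbhs_rational_cube nL.
  exists (rational_cube i, [set t | (choice.pickle i <= t)%N]) => /=.
    by split=> //; exact: nbhs_infty_ge.
  move=> [y t] [/= yi it] Hy.
  have mL : chabauty_miss (rational_cube i) L.
    by apply/seteqP; split=> // z [Lz /iL].
  have [_ /(_ ci mL) mH] := HW i t it.
  by have : (subgroup_set (H_ t) `&` rational_cube i) y by []; rewrite mH.
have [i [ci ni iU]] := nbhs_rational_cube (open_nbhs_nbhs (conj oU Ux)).
apply: filterS (nbhs_infty_ge (choice.pickle i)) => t it.
have hL : chabauty_hit (rational_cube i)° L by exists x.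
have [/(_ hL)[y [Hy yi]] _] := HW i t it.
by exists y; split=> //; apply: iU; exact: interior_subset.
Qed.

End SequentialClosure.

(** * Groups with a prescribed kernel block *)

Lemma preserves_unit (R : realType) n (d : 'rV[R]_n) (A : 'M[R]_n) :
  diag_mx d \in unitmx -> preserves d A -> A \in unitmx.
Proof. by move=> ud /(preserves_formP _ ud)/mulmx1_unit[]. Qed.

Section BlockGroups.
Variables (R : realType) (m n : nat) (f : 'I_m -> 'I_n).
Hypothesis f_inj : injective f.
Variable v : 'rV[R]_n.
Hypothesis vP : forall i, (v 0 i == 0) = (i \in codom f).
Local Notation S := (selmx R f).

Definition section_GL (h : GL R m) : GL R n :=
  GLmk (section_mx_unit f_inj (GLmx_unit h)).

Lemma section_GLE h : GLmx (section_GL h) = section_mx f (GLmx h).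
Proof. exact: GLmxK. Qed.

Lemma section_GL_continuous : continuous section_GL.
Proof.
move=> h; apply/(@GL_cvg R n _ (nbhs h)); rewrite section_GLE.
under eq_fun do rewrite section_GLE.
have cc p q (M : 'M[R]_(p, q)) : M @[_ --> nbhs h] --> M by exact: cvg_cst.
have ch : GLmx x @[x --> h] --> GLmx h by exact: (@GLmx_continuous R m h).
rewrite /section_mx; apply: (cvg_addmx _ (cc _ _ _)).
exact: cvg_mulmx (cvg_mulmx (cc _ _ S^T) ch) (cc _ _ S).
Qed.

Lemma section_GLM g h : section_GL (g * h)%g = (section_GL g * section_GL h)%g.
Proof. by apply: GLmx_inj; rewrite !GLmxK section_mxM. Qed.

Lemma section_GL1 : section_GL 1%g = 1%g.
Proof. by apply: GLmx_inj; rewrite !GLmxK section_mx1. Qed.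

Lemma section_GLV h : section_GL h^-1%g = (section_GL h)^-1%g.
Proof.
apply: GLmx_inj; rewrite !GLmxK.
have uh := GLmx_unit h; have us := section_mx_unit f_inj uh.
apply: (can_inj (mulKmx us)).
by rewrite mulmxV // -section_mxM // mulmxV // section_mx1.
Qed.

Definition block (A : GL R n) : 'M[R]_m := S *m GLmx A *m S^T.

Lemma block_continuous : continuous block.
Proof.
move=> A; have cc p q (M : 'M[R]_(p, q)) : M @[_ --> nbhs A] --> M by exact: cvg_cst.
have cA : GLmx x @[x --> A] --> GLmx A by exact: (@GLmx_continuous R n A).
exact: cvg_mulmx (cvg_mulmx (cc _ _ S) cA) (cc _ _ S^T).
Qed.

Lemma block_section h : block (section_GL h) = GLmx h.
Proof. by rewrite /block section_GLE sel_section_mx. Qed.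

Lemma block_stab_unit A :
  orthogonal_set (diag_mx v) A -> block A \in unitmx.
Proof. by move=> AV; apply: (stab_sel_unit f_inj vP) => //; exact: GLmx_unit. Qed.

Lemma block_stabM A B : orthogonal_set (diag_mx v) B ->
  block (A * B)%g = block A *m block B.
Proof.
by move=> BV; rewrite /block GLmxK (stab_selM f_inj vP) //; exact: GLmx_unit.
Qed.

Lemma section_orthogonal h : orthogonal_set (diag_mx v) (section_GL h).
Proof. by rewrite /orthogonal_set /= section_GLE; exact: (section_stab f_inj vP). Qed.

Definition block_set (L : closed_subgroup (GL R m)) : set (GL R n) :=
  [set A | orthogonal_set (diag_mx v) A /\
           forall h, GLmx h = block A -> subgroup_set L h].

Lemma block_setP L A : orthogonal_set (diag_mx v) A ->
  forall h, GLmx h = block A -> subgroup_set L h -> block_set L A.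
Proof.
move=> AV h hA Lh; split=> // h' h'A.
by have -> : h' = h by apply: GLmx_inj; rewrite hA.
Qed.

Lemma block_set_closed L : closed (block_set L).
Proof.
move=> A clA; split.
  apply: orthogonal_set_closed => U nU.
  by have [B [[BV _] UB]] := clA U nU; exists B.
move=> h hA; apply: closed_subgroup_closed => W /GL_nbhsP[V nV VW].
rewrite hA in nV; have [B [[BV LB] VB]] := clA _ (block_continuous nV).
have hB : GLmx (GLmk (block_stab_unit BV)) = block B by rewrite GLmxK.
exists (GLmk (block_stab_unit BV)); split; first exact: LB.
by apply: VW; rewrite /= hB.
Qed.

Lemma block_set1 L : block_set L 1%g.
Proof.
apply: (@block_setP _ _ _ 1%g); last exact: closed_subgroup1.
  exact: orthogonal_set1.
by rewrite /block !GLmxK mulmx1 selmxK.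
Qed.

Lemma block_setM L A B :
  block_set L A -> block_set L B -> block_set L (A * B)%g.
Proof.
move=> [AV LA] [BV LB].
have hA : GLmx (GLmk (block_stab_unit AV)) = block A by rewrite GLmxK.
have hB : GLmx (GLmk (block_stab_unit BV)) = block B by rewrite GLmxK.
apply: (block_setP (orthogonal_setM AV BV)); last first.
  exact: (closed_subgroupM (LA _ hA) (LB _ hB)).
by rewrite GLmxK hA hB block_stabM.
Qed.

Lemma block_setV L A : block_set L A -> block_set L A^-1%g.
Proof.
move=> [AV LA].
have hA : GLmx (GLmk (block_stab_unit AV)) = block A by rewrite GLmxK.
apply: (block_setP (orthogonal_setV AV)); last first.
  exact: (closed_subgroupV (LA _ hA)).
rewrite GLmxK hA /block GLmxK (stab_sel_invE f_inj vP) //; exact: GLmx_unit.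
Qed.

Definition block_group (L : closed_subgroup (GL R m)) : closed_subgroup (GL R n) :=
  ClosedSubgroup (@block_set_closed L) (block_set1 L) (@block_setM L) (@block_setV L).

Lemma section_in_block L h : block_set L (section_GL h) <-> subgroup_set L h.
Proof.
split=> [[_ Lh]|Lh]; first by apply: Lh; rewrite block_section.
by apply: (block_setP (section_orthogonal h) _ Lh); rewrite block_section.
Qed.

(** For the hitting condition, a kernel block near that of A is realized near A
    by right multiplication by a section element. *)
Lemma block_group_continuous : continuous block_group.
Proof.
move=> L; apply/(@chabauty_cvgP _ _ (nbhs L)); split=> [K cK mK|U oU [A [[AV LA] UA]]].
  suff : \forall H \near L, K `<=` [set A | ~ block_set H A].
    by apply: filterS => H KH; apply/seteqP; split=> // A [HA /KH].
  have := (compact_near_coveringP K).1 cK _ (nbhs L)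
    (fun H A => ~ block_set H A) (nbhs_filter L).
  apply => A KA.
  have [AV|nAV] := pselect (orthogonal_set (diag_mx v) A); last first.
    exists (~` orthogonal_set (diag_mx v), setT) => /=; last first.
      by move=> [B H] [/= nB _] [BV _]; exact: nB.
    split; last exact: filterT.
    apply: open_nbhs_nbhs; split=> //; apply: closed_openC.
    exact: orthogonal_set_closed.
  pose h := GLmk (block_stab_unit AV).
  have hA : GLmx h = block A by rewrite GLmxK.
  have nLh : nbhs h (~` subgroup_set L).
    apply: open_nbhs_nbhs; split.
      by apply: closed_openC; exact: closed_subgroup_closed.
    move=> Lh; have : (block_set L `&` K) A by split=> //; exact: (block_setP AV hA).
    by rewrite mK.
  have [C [cC nC CL]] := GL_compact_nbhs nLh.
  have [V nV VC] := (GL_nbhsP _ _).1 nC; rewrite hA in nV.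
  exists (block @^-1` V, chabauty_miss C) => /=.
    split; first exact: block_continuous.
    apply: open_nbhs_nbhs; split; first exact: chabauty_miss_open.
    by apply/seteqP; split=> // x [Lx /CL].
  move=> [B H] [/= VB mC] [BV HB].
  have hB : GLmx (GLmk (block_stab_unit BV)) = block B by rewrite GLmxK.
  have : (subgroup_set H `&` C) (GLmk (block_stab_unit BV)).
    by split; [exact: HB | apply: VC; rewrite /= hB].
  by rewrite mC.
pose h := GLmk (block_stab_unit AV).
have hA : GLmx h = block A by rewrite GLmxK.
pose move_A g := (A * section_GL (h^-1 * g))%g.
have move_Ah : move_A h = A.
  rewrite /move_A; have -> : (h^-1 * h)%g = 1%g by exact: GLmulV.
  by rewrite section_GL1; exact: GLmulr1.
have nW : nbhs h (move_A @^-1` U).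
  have cM : continuous move_A.
    move=> g; apply/(@GL_cvg R n _ (nbhs g)); rewrite GLmxK section_GLE GLmxK.
    under eq_fun do rewrite GLmxK section_GLE GLmxK.
    have cc p q (M : 'M[R]_(p, q)) : M @[_ --> nbhs g] --> M by exact: cvg_cst.
    have cg : GLmx x @[x --> g] --> GLmx g by exact: (@GLmx_continuous R m g).
    apply: (cvg_mulmx (cc _ _ _)).
    rewrite /section_mx; apply: (cvg_addmx _ (cc _ _ _)).
    exact: cvg_mulmx (cvg_mulmx (cc _ _ S^T) (cvg_mulmx (cc _ _ _) cg)) (cc _ _ S).
  by apply: cM; apply: open_nbhs_nbhs; split=> //; rewrite move_Ah.
have : \forall H \near L, chabauty_hit (move_A @^-1` U)° H.
  apply: open_nbhs_nbhs; split.
    by apply: chabauty_hit_open; exact: open_interior.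
  by exists h; split; [exact: LA | exact: nW].
apply: filterS => H [g [Hg /interior_subset gU]].
exists (move_A g); split=> //.
apply: (block_setP (orthogonal_setM AV (section_orthogonal _)) _ Hg).
rewrite block_stabM; last exact: section_orthogonal.
by rewrite block_section -hA !GLmxK mulKVmx ?block_stab_unit.
Qed.

(** A compact set of blocks is tested on its image by the section, an open one on
    its preimage by the block map. *)
Lemma block_group_cvg_inv (T : Type) (F : set_system T) {FF : Filter F}
    (H_ : T -> closed_subgroup (GL R m)) L :
  block_group (H_ t) @[t --> F] --> block_group L -> H_ t @[t --> F] --> L.
Proof.
move=> /chabauty_cvgP[mB hB]; apply/chabauty_cvgP; split=> [K cK mK|U oU [h [Lh Uh]]].
  have cs : compact (section_GL @` K).
    apply: continuous_compact => //; apply: continuous_subspaceT.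
    exact: section_GL_continuous.
  have : \forall t \near F, chabauty_miss (section_GL @` K) (block_group (H_ t)).
    apply: mB => //; apply/seteqP; split=> // A [LA [h Kh hA]].
    move: LA; rewrite -hA => /section_in_block Lh.
    by have : (subgroup_set L `&` K) h by []; rewrite mK.
  apply: filterS => t mt; apply/seteqP; split=> // h [Hh Kh].
  have : (block_set (H_ t) `&` (section_GL @` K)) (section_GL h).
    by split; [exact/section_in_block | exists h].
  by rewrite [_ `&` _]mt.
pose W : set (GL R n) := [set A | exists2 g, U g & GLmx g = block A].
have nW : nbhs (section_GL h) W.
  have [V nV VU] := (GL_nbhsP _ _).1 (open_nbhs_nbhs (conj oU Uh)).
  have nV' : nbhs (block (section_GL h)) (V `&` [set N : 'M[R]_m | N \in unitmx]).
    by rewrite block_section; apply: filterI => //; exact/unitmx_nbhs/GLmx_unit.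
  have : \forall A \near section_GL h,
      (V `&` [set N : 'M[R]_m | N \in unitmx]) (block A).
    exact: block_continuous nV'.
  apply: filterS => A [VA uA].
  by exists (GLmk uA); rewrite ?GLmxK //; apply: VU; rewrite /= GLmxK.
have : \forall t \near F, chabauty_hit W° (block_group (H_ t)).
  apply: hB; first exact: open_interior.
  by exists (section_GL h); split=> //; exact/section_in_block.
apply: filterS => t [A [[AV HA] /interior_subset[g Ug gA]]].
by exists g; split=> //; exact: HA.
Qed.

Lemma block_group_inj : injective block_group.
Proof.
move=> L L' LL'; apply: closed_subgroup_eq => h.
have sE : block_set L = block_set L' := congr1 (@subgroup_set _) LL'.
by rewrite -!section_in_block sE.
Qed.

Definition section_preimage (L : closed_subgroup (GL R n)) : set (GL R m) :=
  section_GL @^-1` subgroup_set L.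

Lemma section_preimage_closed L : closed (section_preimage L).
Proof.
apply: preimage_closed; first by move=> h _; exact: section_GL_continuous.
exact: closed_subgroup_closed.
Qed.

Lemma section_preimage1 L : section_preimage L 1%g.
Proof. by rewrite /section_preimage /= section_GL1; exact: closed_subgroup1. Qed.

Lemma section_preimageM L g h :
  section_preimage L g -> section_preimage L h -> section_preimage L (g * h)%g.
Proof.
by rewrite /section_preimage /= section_GLM; exact: closed_subgroupM.
Qed.

Lemma section_preimageV L h : section_preimage L h -> section_preimage L h^-1%g.
Proof.
by rewrite /section_preimage /= section_GLV; exact: closed_subgroupV.
Qed.

Definition section_group (L : closed_subgroup (GL R n)) :
    closed_subgroup (GL R m) :=
  ClosedSubgroup (@section_preimage_closed L) (section_preimage1 L)
    (@section_preimageM L) (@section_preimageV L).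

Variable d_ : nat -> 'rV[R]_n.
Hypothesis d_unit : forall t, diag_mx (d_ t) \in unitmx.
Hypothesis d_cvg : d_ t @[t --> \oo] --> v.

Lemma block_group_cvg L :
  orthogonal_group (diag_mx (d_ t *m S^T)) @[t --> \oo] --> L ->
  orthogonal_group (diag_mx (d_ t)) @[t --> \oo] --> block_group L.
Proof.
move=> cL; apply: chabauty_cvg_seq => [A [AV LA]|phi A_ A cphi dA cA].
  pose h := GLmk (block_stab_unit AV).
  have hA : GLmx h = block A by rewrite GLmxK.
  have [h_ dh ch] := chabauty_cvg_approx cL (LA h hA).
  have [|A_ dA cA] := @cvg_lift R m n f f_inj v vP nat \oo _ d_
    (fun t => GLmx (h_ t)) (GLmx A) d_unit d_cvg (GLmx_unit A) AV dh.
    by rewrite hA in ch.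
  exists (fun t => GLmk (preserves_unit (d_unit t) (dA t))) => [t|].
    by rewrite /= /orthogonal_set /= GLmxK; exact: dA.
  by under eq_fun do rewrite GLmxK.
have d_cvg' : d_ (phi j) @[j --> \oo] --> v by exact: cvg_comp cphi d_cvg.
have AV : orthogonal_set (diag_mx v) A by exact: (cvg_preserves d_cvg' cA dA).
have [h_ dh ch] := @cvg_block R m n f f_inj v vP nat \oo _ (d_ \o phi)
  (fun j => GLmx (A_ j)) (GLmx A) (fun j => d_unit (phi j)) d_cvg' cA (GLmx_unit A) dA.
have hA : GLmx (GLmk (block_stab_unit AV)) = block A by rewrite GLmxK.
apply: (block_setP AV hA).
have uh j := preserves_unit (sel_unit f (d_unit (phi j))) (dh j).
apply: (chabauty_cvg_limit cL cphi (x_ := fun j => GLmk (uh j))).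
  by move=> j; rewrite /= /orthogonal_set /= GLmxK; exact: dh.
by under eq_fun do rewrite GLmxK; rewrite hA.
Qed.

(** The section maps O(E_t) into O(D_t), hence sends a limit of elements of the
    former to a limit of elements of the latter; conversely the blocks of the
    elements of O(D_t) are close to O(E_t) by [cvg_block]. *)
Lemma section_group_cvg L :
  orthogonal_group (diag_mx (d_ t)) @[t --> \oo] --> L ->
  orthogonal_group (diag_mx (d_ t *m S^T)) @[t --> \oo] --> section_group L.
Proof.
move=> cL; apply: chabauty_cvg_seq => [h Lh|phi h_ h cphi dh ch].
  have [A_ dA cA] := chabauty_cvg_approx cL Lh.
  have [h_ dh ch] := @cvg_block R m n f f_inj v vP nat \oo _ d_
    (fun j => GLmx (A_ j)) (GLmx (section_GL h)) d_unit d_cvg cA (GLmx_unit _) dA.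
  have uh j := preserves_unit (sel_unit f (d_unit j)) (dh j).
  exists (fun t => GLmk (uh t)) => [t|].
    by rewrite /= /orthogonal_set /= GLmxK; exact: dh.
  under eq_fun do rewrite GLmxK.
  by rewrite -block_section.
apply: (chabauty_cvg_limit cL cphi (x_ := fun j => section_GL (h_ j))).
  move=> j; rewrite /= /orthogonal_set /= section_GLE.
  exact: section_preserves (dh j).
by apply/GL_cvg; apply: continuous_cvg; [exact: section_GL_continuous | exact/GL_cvg].
Qed.

Lemma limit_block_group L :
  orthogonal_group (diag_mx (d_ t)) @[t --> \oo] --> L ->
  L = block_group (section_group L).
Proof.
move=> cL; apply: (chabauty_cvg_unique cL).
exact: block_group_cvg (section_group_cvg cL).
Qed.

End BlockGroups.

(** * Uniqueness of the limit form *)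

Lemma orthogonal_group_scale (R : realType) n (c : R) (d : 'rV[R]_n) : c != 0 ->
  orthogonal_group (diag_mx (c *: d)) = orthogonal_group (diag_mx d).
Proof.
move=> c0; apply: closed_subgroup_eq => A.
rewrite /= /orthogonal_set /= linearZ /= -scalemxAr -scalemxAl.
by split=> [/(scalerI c0)|->].
Qed.

Lemma diag_unit_scale (R : realType) n (c : R) (d : 'rV[R]_n) : c != 0 ->
  diag_mx d \in unitmx -> diag_mx (c *: d) \in unitmx.
Proof.
move=> c0 /diag_unitP ud; apply/diag_unitP => i.
by rewrite mxE mulf_neq0.
Qed.

Section FormUniqueness.
Variables (R : realType) (n : nat).
Implicit Types (u d v w : 'rV[R]_n).

(** The orthogonal reflection in u for the form d, and the identity when u is
    isotropic, since 2 / 0 = 0. *)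
Definition reflection u d : 'M[R]_n :=
  1%:M - (2 / (u *m diag_mx d *m u^T) 0 0) *: (u^T *m u *m diag_mx d).

Lemma reflection_cross u d k : k = 2 / (u *m diag_mx d *m u^T) 0 0 ->
  k ^+ 2 *: (u^T *m u *m diag_mx d *m (u^T *m u *m diag_mx d)) =
  (k + k) *: (u^T *m u *m diag_mx d).
Proof.
move=> kE; set q := (u *m diag_mx d *m u^T) 0 0.
have -> : u^T *m u *m diag_mx d *m (u^T *m u *m diag_mx d) =
          u^T *m (u *m diag_mx d *m u^T) *m (u *m diag_mx d) by rewrite !mulmxA.
have -> : u *m diag_mx d *m u^T = q%:M by rewrite [LHS]mx11_scalar.
rewrite mul_mx_scalar -scalemxAl scalerA mulmxA; congr (_ *: _).
rewrite kE -/q expr2; have [->|q0] := eqVneq q 0; first by rewrite invr0 !mulr0 add0r.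
by rewrite -mulrA divfK // mulr2n mulrDr mulr1.
Qed.

Lemma reflectionK u d : reflection u d *m reflection u d = 1%:M.
Proof.
rewrite /reflection; set k := 2 / _; set X := _ *m diag_mx d.
have XX : k ^+ 2 *: (X *m X) = (k + k) *: X by exact: reflection_cross.
rewrite mulmxBl mul1mx mulmxBr mulmx1 -scalemxAl -scalemxAr scalerA -expr2 XX.
by rewrite scalerDl opprB addrK subrK.
Qed.

Lemma tr_reflection u d :
  (reflection u d)^T *m diag_mx d = diag_mx d *m reflection u d.
Proof.
rewrite /reflection linearB /= linearZ /= trmx1 !trmx_mul trmxK tr_diag_mx.
rewrite mulmxBl mul1mx mulmxBr mulmx1 -scalemxAl -scalemxAr.
by rewrite !mulmxA.
Qed.

Lemma reflection_preserves u d : preserves d (reflection u d).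
Proof. by rewrite /preserves tr_reflection -mulmxA reflectionK mulmx1. Qed.

Lemma reflection_unit u d : reflection u d \in unitmx.
Proof. by have [] := mulmx1_unit (reflectionK u d). Qed.

Lemma cvg_reflection (T : Type) (F : set_system T) {FF : Filter F} u
    (d_ : T -> 'rV[R]_n) v :
  d_ t @[t --> F] --> v -> (u *m diag_mx v *m u^T) 0 0 != 0 ->
  reflection u (d_ t) @[t --> F] --> reflection u v.
Proof.
move=> cd q0.
have cc p q (M : 'M[R]_(p, q)) : M @[_ --> F] --> M by exact: cvg_cst.
have cq : u *m diag_mx (d_ t) *m u^T @[t --> F] --> u *m diag_mx v *m u^T.
  exact: cvg_mulmx (cvg_mulmx (cc _ _ u) (cvg_diag_mx cd)) (cc _ _ u^T).
apply: (cvg_submx (cc _ _ 1%:M)); apply: cvg_scalemx.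
  apply: cvgM; first exact: cvg_cst.
  by apply: cvgV => //; exact: (mx_cvgP _ _).1 cq 0 0.
exact: cvg_mulmx (cc _ _ _) (cvg_diag_mx cd).
Qed.

Lemma nonisotropic v : v != 0 ->
  exists2 u : 'rV[R]_n, forall i, u 0 i != 0 & (u *m diag_mx v *m u^T) 0 0 != 0.
Proof.
move=> /rV0Pn[i0 vi0].
have qE u : (u *m diag_mx v *m u^T) 0 0 = \sum_i u 0 i ^+ 2 * v 0 i.
  rewrite mxE; apply: eq_bigr => i _.
  by rewrite mul_mx_diag !mxE expr2 mulrAC.
have [s0|s0] := eqVneq (\sum_i v 0 i) 0; last first.
  exists (const_mx 1) => [i|]; first by rewrite mxE oner_neq0.
  by rewrite qE; under eq_bigr do rewrite mxE expr1n mul1r.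
exists (\row_i (if i == i0 then 2 else 1)) => [i|].
  by rewrite mxE; case: ifP => _; rewrite ?oner_neq0 ?pnatr_eq0.
rewrite qE (bigD1 i0) //= mxE eqxx.
under eq_bigr => i ii0 do rewrite mxE (negPf ii0) expr1n mul1r.
have -> : \sum_(i < n | i != i0) v 0 i = - v 0 i0.
  by apply/eqP; rewrite -addr_eq0 addrC; move: s0; rewrite (bigD1 i0) //= => ->.
have -> : 2 ^+ 2 * v 0 i0 - v 0 i0 = 3 * v 0 i0.
  by ring.
by rewrite mulf_neq0 ?pnatr_eq0.
Qed.

(** The reflection r in u is an involution, so invariance of w makes
    diag(w) r symmetric.  The rank one part of this symmetry says that the
    covectors of u for v and w are proportional. *)
Lemma invariant_form_proportional u v w : (forall i, u 0 i != 0) ->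
  (u *m diag_mx v *m u^T) 0 0 != 0 ->
  preserves w (reflection u v) -> forall i j, v 0 i * w 0 j = w 0 i * v 0 j.
Proof.
move=> u0 q0 pw i j.
have : (reflection u v)^T *m diag_mx w = diag_mx w *m reflection u v.
  by rewrite -[LHS]mulmx1 -(reflectionK u v) mulmxA pw.
rewrite /reflection; set k := 2 / _.
have k0 : k != 0 by rewrite mulf_neq0 ?invr_eq0 ?pnatr_eq0.
rewrite linearB /= linearZ /= trmx1 mulmxBl mul1mx mulmxBr mulmx1.
move=> /addrI/oppr_inj; rewrite -scalemxAl -scalemxAr => /(scalerI k0).
rewrite !trmx_mul trmxK tr_diag_mx => /matrixP/(_ i j).
rewrite !mulmxA !(mul_mx_diag, mul_diag_mx) !mxE !big_ord1.
rewrite !mxE => e.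
have {}e : v 0 i * u 0 i * u 0 j * w 0 j = w 0 i * u 0 i * u 0 j * v 0 j by exact: e.
apply: (mulfI (mulf_neq0 (u0 i) (u0 j))); ring: e.
Qed.

Lemma limit_form_unique (L : closed_subgroup (GL R n)) (d_ e_ : nat -> 'rV[R]_n) v w :
  (forall t, diag_mx (d_ t) \in unitmx) ->
  d_ t @[t --> \oo] --> v -> e_ t @[t --> \oo] --> w ->
  orthogonal_group (diag_mx (d_ t)) @[t --> \oo] --> L ->
  orthogonal_group (diag_mx (e_ t)) @[t --> \oo] --> L ->
  v != 0 -> w != 0 -> exists2 c, c != 0 & v = c *: w.
Proof.
move=> ud cd ce cdL ceL v0 w0.
have [u u0 q0] := nonisotropic v0.
pose r := GLmk (reflection_unit u v).
have Lr : subgroup_set L r.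
  apply: (chabauty_cvg_limit cdL (phi := id)
            (x_ := fun t => GLmk (reflection_unit u (d_ t)))).
  - by [].
  - by move=> t; rewrite /= /orthogonal_set /= GLmxK; exact: reflection_preserves.
  - by under eq_fun do rewrite GLmxK; rewrite GLmxK; exact: cvg_reflection.
have [r_ er cr] := chabauty_cvg_approx ceL Lr.
have pw : preserves w (reflection u v).
  by rewrite GLmxK in cr; exact: (cvg_preserves ce cr er).
have vw := invariant_form_proportional u0 q0 pw.
have [i wi] := rV0Pn _ w0.
have vE : v = (v 0 i / w 0 i) *: w.
  by apply/rowP => j; rewrite mxE mulrAC -[RHS]mulrC vw mulKf.
exists (v 0 i / w 0 i) => //.
by apply: contraNneq v0 => c0; rewrite vE c0 scale0r.
Qed.

End FormUniqueness.

(** * Limit forms in projective space *)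

Section ProjectiveLimits.
Variables (R : realType) (n : nat).
Local Notation RP := (RP R n).
Local Notation nzvec := (nonzero_vector R n).

Definition nzvec_of (v : 'rV[R]_n.+1) (v0 : v != 0) : nzvec :=
  SigSub (mem_set v0 : _ \in [set v : 'rV[R]_n.+1 | v != 0]).

Lemma nzvec_ofK v v0 : vector_of (@nzvec_of v v0) = v.
Proof. by rewrite /vector_of set_valE. Qed.

Lemma vector_of_neq0 (v : nzvec) : vector_of v != 0.
Proof. exact: (set_valP v). Qed.

Lemma vector_of_continuous : continuous (@vector_of R n).
Proof. exact: initial_continuous. Qed.

Lemma RPclass_eq (u v : nzvec) : RPclass u = RPclass v <->
  exists2 c : R, c != 0 & vector_of u = c *: vector_of v.
Proof.
split=> [|uv]; first by move=> /eqmodP /= /asboolP.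
by apply/eqmodP; apply/asboolP.
Qed.

Lemma RPclass_surj (p : RP) : exists v, p = RPclass v.
Proof. by exists (repr p); rewrite /RPclass reprK. Qed.

Lemma RPclass_cvg (T : Type) (F : set_system T) {FF : Filter F}
    (d : T -> nzvec) (v : nzvec) :
  vector_of (d t) @[t --> F] --> vector_of v ->
  RPclass (d t) @[t --> F] --> RPclass v.
Proof.
move=> cd; apply: continuous_cvg; first exact: pi_continuous.
exact/(@cvg_set_type _ _ T F).
Qed.

(** Scaling the i0-th coordinate to that of v is constant on classes and
    continuous near v, so it descends to a neighbourhood of the class of v. *)
Lemma RPclass_cvg_normalized (T : Type) (F : set_system T) {FF : Filter F}
    (d : T -> nzvec) (v : nzvec) :
  (forall t i, vector_of (d t) 0 i != 0) ->
  RPclass (d t) @[t --> F] --> RPclass v ->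
  exists2 c : T -> R, forall t, c t != 0 &
    c t *: vector_of (d t) @[t --> F] --> vector_of v.
Proof.
move=> d0 cd; have [i0 vi0] := rV0Pn _ (vector_of_neq0 v).
pose nu (x : 'rV[R]_n.+1) : 'rV[R]_n.+1 := (vector_of v 0 i0 / x 0 i0) *: x.
have nuZ c x : c != 0 -> nu (c *: x) = nu x.
  move=> c0; rewrite /nu scalerA mxE -mulrA; congr (_ * _ *: _).
  by rewrite invfM mulrAC mulVf // mul1r.
have nuv : nu (vector_of v) = vector_of v by rewrite /nu divff // scale1r.
have cnu (x : 'rV[R]_n.+1) : x 0 i0 != 0 -> nu y @[y --> x] --> nu x.
  move=> x0.
  have cr : (fun y : 'rV[R]_n.+1 => vector_of v 0 i0 / y 0 i0) @ x -->
            vector_of v 0 i0 / x 0 i0.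
    apply: (@cvgM R _ (nbhs x) _ (fun=> vector_of v 0 i0)
              (fun y : 'rV[R]_n.+1 => (y 0 i0)^-1)); first exact: cvg_cst.
    by apply: cvgV => //; exact: (@coord_continuous R 1 n.+1 0 i0 x).
  exact: (@cvg_scalemx R _ (nbhs x) _ _ _ _ id _ _ cr cvg_id).
exists (fun t => vector_of v 0 i0 / vector_of (d t) 0 i0) => [t|].
  by rewrite mulf_neq0 ?invr_eq0.
move=> U; rewrite nbhsE => -[U' [oU' U'v] U'U].
pose Sat : set nzvec := [set y | vector_of y 0 i0 != 0 /\ U' (nu (vector_of y))].
have SatP (x y : nzvec) : RPclass x = RPclass y -> Sat y -> Sat x.
  move=> /RPclass_eq[c c0 xy] [y0 Uy]; split; first by rewrite xy mxE mulf_neq0.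
  by rewrite xy nuZ.
have oSat : open Sat.
  rewrite openE => y [y0 Uy].
  have ny : nbhs (vector_of y) [set x : 'rV[R]_n.+1 | x 0 i0 != 0 /\ U' (nu x)].
    apply: filterI; last by apply: cnu => //; exact: open_nbhs_nbhs.
    apply: (@coord_continuous R 1 n.+1 0 i0 (vector_of y) [set x : R | x != 0]).
    by apply: open_nbhs_nbhs; split=> //; exact: open_neq.
  exact: (vector_of_continuous ny).
have nW : nbhs (RPclass v) [set q | exists2 y, q = RPclass y & Sat y].
  apply: open_nbhs_nbhs; split; last by exists v => //; split; rewrite ?nuv.
  rewrite /open /= /quotient_open.
  rewrite (_ : _ @^-1` _ = Sat) //; apply/seteqP; split=> [x /= [y xy]|x Sx /=].
    exact: SatP.
  by exists x.
have : \forall t \near F, exists2 y, RPclass (d t) = RPclass y & Sat y := cd _ nW.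
rewrite /nbhs /=; apply: filterS => t [y dy Sy]; apply: U'U.
by have [_] := SatP _ _ dy Sy.
Qed.

Lemma limit_formP (L : Dbar R n.+1) (v : nzvec) : limit_form L (RPclass v) <->
  exists d : nat -> 'rV[R]_n.+1,
    [/\ forall t, diag_mx (d t) \in unitmx,
        orthogonal_group (diag_mx (d t)) @[t --> \oo] -->
          (set_val L : closed_subgroup (GL R n.+1)) &
        d t @[t --> \oo] --> vector_of v].
Proof.
split=> [[d [ud cL cd]]|[d [ud cL cd]]].
  have [|c c0 cc] := RPclass_cvg_normalized _ cd.
    by move=> t; exact/diag_unitP.
  exists (fun t => c t *: vector_of (d t)); split=> // [t|].
    exact: diag_unit_scale.
  by under eq_fun do rewrite orthogonal_group_scale //.
have d0 t : d t != 0.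
  apply/rV0Pn; exists ord0; exact: (diag_unitP _).1 (ud t) ord0.
exists (fun t => nzvec_of (d0 t)); split=> [t||].
- by rewrite nzvec_ofK.
- by under eq_fun do rewrite nzvec_ofK.
- by apply: RPclass_cvg; under eq_fun do rewrite nzvec_ofK.
Qed.

Lemma limit_form_inj (L : Dbar R n.+1) (p q : RP) :
  limit_form L p -> limit_form L q -> p = q.
Proof.
have [v ->] := RPclass_surj p; have [w ->] := RPclass_surj q.
move=> /limit_formP[d [ud dL dv]] /limit_formP[e [ue eL ew]].
apply/RPclass_eq.
exact: (limit_form_unique ud dv ew dL eL (vector_of_neq0 v) (vector_of_neq0 w)).
Qed.

Lemma cluster_subseq (x_ : nat -> 'rV[R]_n.+1) (K : set 'rV[R]_n.+1) :
  compact K -> (forall t, K (x_ t)) ->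
  exists phi x, [/\ phi j @[j --> \oo] --> \oo, K x &
                    x_ (phi j) @[j --> \oo] --> x].
Proof.
move=> cK Kx; have FK : \forall t \near \oo, K (x_ t) by exact: nearW.
have [x [Kx' clx]] := cK (x_ @ \oo) _ FK.
have /choice[phi phiP] : forall j, exists t,
    (j <= t)%N /\ cube j.+1%:R^-1 x (x_ t).
  move=> j.
  have Aj : \forall t \near \oo, [set x_ t | t in [set t | (j <= t)%N]] (x_ t).
    by apply: filterS (nbhs_infty_ge j) => t jt; exists t.
  have j0 : (0 : R) < j.+1%:R^-1 by rewrite invr_gt0.
  have [_ [[t jt <-] xt]] := clx _ _ Aj (cube_nbhs x j0).
  by exists t.
exists phi, x; split=> //.
  move=> A [N _ NA]; exists N => // j /= Nj; apply: NA => /=.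
  by have [js _] := phiP j; exact: leq_trans js.
by apply: cvg_cube => j; have [] := phiP j.
Qed.

Lemma limit_form_exists (L : Dbar R n.+1) : exists p, limit_form L p.
Proof.
have clL : closure (@diag_orthogonal_groups R n.+1) (set_val L) := set_valP L.
have [H_ HD HL] := chabauty_closure_seq clL.
have /choice[d dP] : forall t, exists d : 'rV[R]_n.+1,
    diag_mx d \in unitmx /\ orthogonal_group (diag_mx d) = H_ t.
  by move=> t; have [d ud dH] := HD t; exists d.
(* The forms are normalized to have l1-norm 1, a compact condition that excludes
   the zero form in the limit. *)
pose l1 (x : 'rV[R]_n.+1) := \sum_i `|x 0 i|.
have l1_ge0 x : 0 <= l1 x by exact: sumr_ge0.
have l1d t : l1 (d t) != 0.
  rewrite psumr_neq0 //; apply/hasP; exists ord0; first exact: mem_index_enum.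
  by rewrite /= normr_gt0; exact: (diag_unitP _).1 (dP t).1 ord0.
have cl1 : continuous l1.
  move=> x; apply: (@cvg_big R _ +%R 0 xpredT add_continuous _ (nbhs x)) => i _.
  by apply: cvg_norm; exact: coord_continuous.
pose K := cube 1 0 `&` [set x : 'rV[R]_n.+1 | l1 x = 1].
have cK : compact K.
  apply: compact_closedI; first exact: cube_compact.
  apply: (@preimage_closed _ _ l1 [set x : R | x = 1]) => [x _|].
    exact: cl1.
  exact: closed_eq.
pose e t := (l1 (d t))^-1 *: d t.
have l1e t : l1 (e t) = 1.
  rewrite /l1; under eq_bigr do rewrite mxE normrM.
  by rewrite -mulr_sumr ger0_norm ?invr_ge0 // mulVf.
have Ke t : K (e t).
  split=> // i j; rewrite (ord1 i) [X in _ - X]mxE subr0.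
  by rewrite -(l1e t) /l1 (bigD1 j) //= lerDl sumr_ge0.
have [phi [v [cphi [_ l1v] ev]]] := cluster_subseq cK Ke.
have v0 : v != 0.
  apply/eqP => v0; have lv0 : l1 v = 0.
    by rewrite v0 /l1 big1 // => i _; rewrite mxE normr0.
  have l1v1 : l1 v = 1 := l1v.
  by move: lv0; rewrite l1v1 => /eqP; rewrite oner_eq0.
exists (RPclass (nzvec_of v0)); apply/limit_formP; exists (e \o phi); split=> /=.
- by move=> t; apply: diag_unit_scale; [rewrite invr_eq0 | exact: (dP _).1].
- under eq_fun do rewrite orthogonal_group_scale ?invr_eq0 // (dP _).2.
  exact: cvg_comp cphi HL.
- by rewrite nzvec_ofK.
Qed.

Lemma projectionP (L : Dbar R n.+1) : limit_form L (projection L).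
Proof. by have [p pL] := limit_form_exists L; exact: (@getI _ _ p). Qed.

Lemma projectionE (L : Dbar R n.+1) p : limit_form L p -> projection L = p.
Proof. exact: limit_form_inj (projectionP L). Qed.

End ProjectiveLimits.

(** * The fibers of the projection *)

Lemma closure_cvg_seq (X : topologicalType) (A : set X) (x_ : nat -> X) x :
  (forall t, A (x_ t)) -> x_ t @[t --> \oo] --> x -> closure A x.
Proof.
move=> Ax cx B nB; have : \forall t \near \oo, B (x_ t) := cx B nB.
by move=> /filter_ex[t Bt]; exists (x_ t).
Qed.

Section Fiber.
Variables (R : realType) (m n : nat) (f : 'I_m -> 'I_n.+1).
Hypothesis f_inj : injective f.
Variable v : nonzero_vector R n.
Hypothesis vP : forall i, (vector_of v 0 i == 0) = (i \in codom f).
Local Notation S := (selmx R f).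

(** The e_t are scaled to tend to zero, which leaves their orthogonal groups
    unchanged, and placed on the kernel of v. *)
Lemma degenerating_seq (e : nat -> 'rV[R]_m) :
  (forall t, diag_mx (e t) \in unitmx) ->
  exists d : nat -> 'rV[R]_n.+1, [/\ forall t, diag_mx (d t) \in unitmx,
    d t @[t --> \oo] --> vector_of v &
    forall t, orthogonal_group (diag_mx (d t *m S^T)) =
              orthogonal_group (diag_mx (e t))].
Proof.
move=> ue.
(* The summand 1 keeps the sum positive when m = 0. *)
pose c t := ((1 + \sum_j `|e t 0 j|) * t.+1%:R)^-1.
have s1 t : 1 <= 1 + \sum_j `|e t 0 j| by rewrite lerDl sumr_ge0.
have c0 t : 0 < c t.
  by rewrite invr_gt0 mulr_gt0 // ?ltr0n // (lt_le_trans _ (s1 t)).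
have ce t j : `|c t * e t 0 j| <= t.+1%:R^-1.
  rewrite normrM gtr0_norm // /c invfM mulrAC -[leRHS]mul1r ler_wpM2r ?invr_ge0 //.
  rewrite mulrC ler_pdivrMr ?mul1r; last exact: lt_le_trans (s1 t).
  by rewrite (bigD1 j) //= addrCA lerDl addr_ge0 // sumr_ge0.
have cE : (fun t => c t *: e t) @ \oo --> (0 : 'rV[R]_m).
  apply: cvg_cube => t i j.
  by rewrite [X in _ - X]mxE subr0 mxE ord1.
have dS t : (vector_of v + c t *: e t *m S) *m S^T = c t *: e t.
  rewrite mulmxDl -mulmxA selmxK // mulmx1.
  suff -> : vector_of v *m S^T = 0 by rewrite add0r.
  rewrite mul_tr_selmx; apply/rowP => j; rewrite !mxE.
  by apply/eqP; rewrite vP codom_f.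
exists (fun t => vector_of v + c t *: e t *m S); split=> [t||t].
- apply/diag_unitP => i; rewrite mxE.
  have [/codomP[j ij]|ni] := boolP (i \in codom f).
    have -> : vector_of v 0 i = 0 by apply/eqP; rewrite vP ij codom_f.
    rewrite add0r mxE (bigD1 j) //= big1 => [|k kj]; rewrite !mxE ij.
      rewrite eqxx mulr1 addr0; apply: mulf_neq0; first by rewrite gt_eqF.
      exact: (diag_unitP _).1 (ue t) j.
    by rewrite (inj_eq f_inj) (negPf kj) mulr0.
  rewrite mxE big1 ?addr0 => [|k _]; first by rewrite vP.
  rewrite !mxE; case: eqP => [fk|_]; rewrite ?mulr0 //.
  by rewrite -fk codom_f in ni.
- have cc p q (M : 'M[R]_(p, q)) : M @[_ --> \oo] --> M by exact: cvg_cst.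
  rewrite -[X in _ --> X]addr0 -[X in _ + X](mul0mx _ S).
  exact: cvg_addmx (cc _ _ _) (cvg_mulmx cE (cc _ _ _)).
- by rewrite dS orthogonal_group_scale // gt_eqF.
Qed.

Local Notation Block := (block_group f_inj vP).

Lemma block_group_fiber (y : Dbar R m) :
  exists x : fiber (RPclass v), set_val (set_val x) = Block (set_val y).
Proof.
have [H_ HD HL] := chabauty_closure_seq (set_valP y : closure _ (set_val y)).
have /choice[e eP] : forall t, exists d : 'rV[R]_m,
    diag_mx d \in unitmx /\ orthogonal_group (diag_mx d) = H_ t.
  by move=> t; have [d ud dH] := HD t; exists d.
have [d [ud dv dS]] := degenerating_seq (fun t => (eP t).1).
have cB : orthogonal_group (diag_mx (d t)) @[t --> \oo] --> Block (set_val y).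
  apply: (block_group_cvg ud dv).
  by under eq_fun do rewrite dS (eP _).2.
have clB : closure (@diag_orthogonal_groups R n.+1) (Block (set_val y)).
  by apply: closure_cvg_seq cB => t; exists (d t) => //; exact: ud.
pose L : Dbar R n.+1 := SigSub (mem_set clB).
have LE : set_val L = Block (set_val y) by rewrite set_valE.
have pL : (@projection R n @^-1` [set RPclass v]) L.
  by apply/projectionE/limit_formP; exists d; split=> //; rewrite LE.
by exists (SigSub (mem_set pL)); rewrite set_valE.
Qed.

Lemma fiber_block_group (x : fiber (RPclass v)) :
  exists y : Dbar R m, set_val (set_val x) = Block (set_val y).
Proof.
have px : projection (set_val x) = RPclass v := set_valP x.
have := projectionP (set_val x); rewrite px => /limit_formP[d [ud dL dv]].
have cS := @section_group_cvg _ _ _ _ f_inj _ vP _ ud dv _ dL.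
have clS : closure (@diag_orthogonal_groups R m)
    (section_group f_inj (set_val (set_val x))).
  by apply: closure_cvg_seq cS => t; exists (d t *m S^T) => //; exact/sel_unit/ud.
exists (SigSub (mem_set clS)).
have -> : set_val (SigSub (mem_set clS) : Dbar R m) =
          section_group f_inj (set_val (set_val x)) by rewrite set_valE.
exact: limit_block_group ud dv _ dL.
Qed.

(** Both Chabauty closures are compared through [block_group], which is a
    topological embedding of one space of closed subgroups into the other. *)
Lemma fiber_homeomorphic : homeomorphic (fiber (RPclass v)) (Dbar R m).
Proof.
have /choice[F FP] := fiber_block_group.
have /choice[G GP] := block_group_fiber.
have val2_inj (x x' : fiber (RPclass v)) :
    set_val (set_val x) = set_val (set_val x') -> x = x'.
  by move=> xx; apply: val_inj; apply: val_inj; exact: xx.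
exists F, G; split.
- by move=> x; apply: val2_inj; rewrite GP -FP.
- move=> y; apply: val_inj; apply: (@block_group_inj _ _ _ _ f_inj _ vP).
  by rewrite -FP GP.
- apply: continuous_set_type => x.
  apply: (@block_group_cvg_inv _ _ _ _ f_inj _ vP _ (nbhs x)).
  rewrite -FP; under eq_fun do rewrite -FP.
  apply: continuous_comp; exact: initial_continuous.
- apply: continuous_set_type; apply: continuous_set_type.
  have -> : (fun y => set_val (set_val (G y))) = Block \o set_val.
    by apply/funext => y; rewrite GP.
  move=> y; apply: continuous_comp; first exact: initial_continuous.
  exact: block_group_continuous.
Qed.

End Fiber.

Theorem mainTheorem1 (R : realType) (n k : nat) (p : RP R n) :
  in_cell k p -> homeomorphic (fiber p) (Dbar R (n.+1 - k - 1)%N).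
Proof.
move=> [_ [I [q [cI _ ->]]] /connected_component_sub[v vI <-]].
set m := (n.+1 - k - 1)%N.
have cIC : m = #|~: I|.
  by rewrite cardsCs finset.setCK card_ord cI /m -subnDA addn1.
pose f (j : 'I_m) : 'I_n.+1 := enum_val (cast_ord cIC j).
apply: (@fiber_homeomorphic R m n f).
  by move=> i j /enum_val_inj /cast_ord_inj.
move=> i; rewrite -[LHS]negbK vI; apply/idP/codomP => [iI|[j ->]].
  have iC : i \in ~: I by rewrite inE.
  exists (cast_ord (esym cIC) (enum_rank_in iC i)).
  by rewrite /f cast_ordKV enum_rankK_in.
by have := enum_valP (cast_ord cIC j); rewrite inE.
Qed.
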